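(* The Rains maps $\circ^\Gamma_G:\overline{\mathcal M}(\Gamma/G)\times\overline{\mathcal M}(\Gamma|_G)\to\overline{\mathcal M}(\Gamma)$ define a contractad structure (in the category of complex projective varieties with the cartesian product) on the graphical collection $\overline{\mathcal M}$ of graphical wonderful compactifications.
   Context: Graphs are finite, simple, undirected, with non-empty vertex set. A tube of $\Gamma$ is a non-empty $G\subset V_\Gamma$ with connected induced subgraph $\Gamma|_G$; it is trivial if $|G|=1$. For a tube $G$, $\Gamma/G$ is the graph with vertices $\{G\}$ and $\{v\}$, $v\notin G$, two distinct blocks being adjacent iff their union is a tube. $\mathsf P_1$ is the one-vertex graph. Contractads. A graphical collection in a symmetric monoidal category is a contravariant functor $\mathcal P$ from the groupoid of connected graphs and isomorphisms to it. A contractad is a graphical collection with a unit $u:1\to\mathcal P(\mathsf P_1)$ and infinitesimal compositions $\circ^\Gamma_G:\mathcal P(\Gamma/G)\otimes\mathcal P(\Gamma|_G)\to\mathcal P(\Gamma)$, for all connected $\Gamma$ and tubes $G$, natural under graph isomorphisms and satisfying: $\lambda\circ_{\{v\}}\mathrm{Id}=\lambda=\mathrm{Id}\circ_{V_\Gamma}\lambda$, where $\mathrm{Id}$ is given by $u$; $(\lambda\circ_{G_2}\nu_2)\circ_{G_1}\nu_1=(\lambda\circ_{G_1}\nu_1)\circ_{G_2}\nu_2$ for disjoint tubes $G_1,G_2$; $\lambda\circ_H(\mu\circ_G\nu)=(\lambda\circ_{H/G}\mu)\circ_G\nu$ for tubes $G\subset H$, where $H/G$ is the image of $H$ in $\Gamma/G$.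 Graphical wonderful compactifications. For a finite set $S$ with $|S|\ge2$ let $V_S=\mathbb C^S/\mathbb C\cdot(1,\dots,1)$. For a connected graph $\Gamma$ with at least one edge put $V=V_{V_\Gamma}$ and $\mathcal M(\Gamma)=\mathbb P(V)\setminus\bigcup_{(v,w)\in E_\Gamma}\mathbb P(\{x_v=x_w\})$. For a non-trivial tube $H$ let $W_H\subset V$ be the subspace where all $x_v$, $v\in H$, coincide, so $V/W_H=V_H$ (restriction of coordinates to $H$). The subspaces $W_H$, $H$ ranging over non-trivial tubes, form the graphical building set. $\overline{\mathcal M}(\Gamma)$ is the closure of the image of $\mathcal M(\Gamma)$ in $\prod_{H}\mathbb P(V_H)$ ($H$ over non-trivial tubes) under the product of the projections $\rho_H:\mathcal M(\Gamma)\to\mathbb P(V_H)$; $\rho_H$ also denotes the resulting projection $\overline{\mathcal M}(\Gamma)\to\mathbb P(V_H)$. Set $\overline{\mathcal M}(\mathsf P_1)=\mathrm{pt}$. Isomorphisms of graphs act by permuting coordinates, making $\overline{\mathcal M}$ a graphical collection. Rains maps. Let $G$ be a non-trivial tube, $G\ne V_\Gamma$. The map $\circ^\Gamma_G:\overline{\mathcal M}(\Gamma/G)\times\overline{\mathcal M}(\Gamma|_G)\to\overline{\mathcal M}(\Gamma)$ is determined by its components $\rho_H\circ(\circ^\Gamma_G)$: if $H\subset G$, this component is the projection to $\overline{\mathcal M}(\Gamma|_G)$ followed by $\rho_H$; if $H\not\subset G$, let $H'$ be the image of $H$ in $\Gamma/G$ (a non-trivial tube); the component is the projection to $\overline{\mathcal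 M}(\Gamma/G)$ followed by $\rho_{H'}$ and by the embedding $\mathbb P(V_{H'})\hookrightarrow\mathbb P(V_H)$ induced by pulling back functions along the surjection $H\to H'$. For $|G|=1$ or $G=V_\Gamma$, $\circ^\Gamma_G$ is the canonical identification (one factor being a point). *)

(* Defs.v *)
From HB Require Import structures.
From mathcomp Require Import all_boot all_order all_algebra generic_quotient.
From mathcomp Require Import boolp.

Set Implicit Arguments.
Unset Strict Implicit.
Unset Printing Implicit Defensive.

(* Connectedness includes non-emptiness. *)
Definition connected_rel (T : finType) (e : rel T) : bool :=
  (0 < #|T|) && [forall x, forall y, connect e x y].

Record cgraph : Type := CGraph {
  vert :> finType;
  adj : rel vert;
  adj_sym : symmetric adj;
  adj_irr : irreflexive adj;
  vert_conn : connected_rel adj }.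
Arguments adj {c} : rename.

Definition ind_adj (Gam : cgraph) (G : {set Gam}) : rel {v : Gam | v \in G} :=
  fun x y => adj (val x) (val y).

Definition is_tube (Gam : cgraph) (G : {set Gam}) : bool :=
  connected_rel (@ind_adj Gam G).

Record tube (Gam : cgraph) : Type := Tube {
  tset :> {set Gam};
  tubeP : is_tube tset }.

Section TubeTheory.
Variable Gam : cgraph.
Implicit Types A B : {set Gam}.

Let relA A : rel Gam := [rel x y | [&& x \in A, y \in A & adj x y]].

Lemma is_tubeP A : reflect
  ((exists x, x \in A) /\ {in A &, forall x y, connect (relA A) x y})
  (is_tube A).
Proof.
apply: (iffP andP) => [[/card_gt0P[[x xA] _] /'forall_forallP cA] | [[x xA] cA]].
  split; first by exists x.
  move=> {}x y {}xA yA.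
  have /connectP[p pp] := cA (exist _ x xA) (exist _ y yA).
  move/(congr1 val) => /= ->.
  rewrite -[x in connect _ x _]/(val (exist (fun v => v \in A) x xA)).
  elim: p (exist _ x xA) pp => //= z p IH w /andP[wz pz].
  apply: connect_trans (IH _ pz); apply: connect1.
  by rewrite /relA /= (valP w) (valP z).
split; first by apply/card_gt0P; exists (exist _ x xA).
apply/'forall_forallP => -[y yA] [z zA].
have /connectP[p] := cA _ _ yA zA.
elim: p y yA => [|w p IH] y yA /=.
  by move=> _ zy; move: zA; rewrite zy => zA; rewrite (bool_irrelevance yA zA).
case/andP=> /and3P[_ wA yw] pw zE.
by apply: connect_trans (IH w wA pw zE); apply: connect1.
Qed.

Lemma relA_sym A : connect_sym (relA A).
Proof.
apply: sym_connect_sym => x y; rewrite /relA /= adj_sym.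
by rewrite andbA [(x \in A) && _]andbC -andbA.
Qed.

Lemma relAS A B x y : A \subset B -> connect (relA A) x y -> connect (relA B) x y.
Proof.
move=> sAB; apply: connect_sub => u v /and3P[uA vA uv].
by apply: connect1; rewrite /relA /= !(subsetP sAB).
Qed.

Lemma is_tube1 (x : Gam) : is_tube [set x].
Proof.
apply/is_tubeP; split; first by exists x; rewrite inE.
by move=> y z; rewrite !inE => /eqP-> /eqP->.
Qed.

Lemma is_tubeT : is_tube [set: Gam].
Proof.
case/andP: (vert_conn Gam) => /card_gt0P[x _] /'forall_forallP cG.
apply/is_tubeP; split; first by exists x; rewrite inE.
move=> y z _ _; apply: connect_sub (cG y z) => u v uv.
by apply: connect1; rewrite /relA /= !inE.
Qed.

Lemma is_tubeU A B x y : is_tube A -> is_tube B -> x \in A -> y \in B ->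
  (x == y) || adj x y -> is_tube (A :|: B).
Proof.
move=> /is_tubeP[_ cA] /is_tubeP[_ cB] xA yB xy.
have xyU : connect (relA (A :|: B)) x y.
  case/orP: xy => [/eqP->//|xy]; apply: connect1.
  by rewrite /relA /= !inE xA yB orbT.
have sA : A \subset A :|: B by exact: subsetUl.
have sB : B \subset A :|: B by exact: subsetUr.
have toy z : z \in A :|: B -> connect (relA (A :|: B)) z y.
  rewrite inE => /orP[zA|zB]; last exact: relAS (cB _ _ zB yB).
  by apply: connect_trans xyU; apply: relAS (cA _ _ zA xA).
apply/is_tubeP; split; first by exists x; rewrite inE xA.
move=> z w zU wU; apply: connect_trans (toy z zU) _.
by rewrite relA_sym toy.
Qed.

Lemma is_tubeU_adj A B : is_tube A -> is_tube B -> [disjoint A & B] ->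
  is_tube (A :|: B) -> exists x y, [/\ x \in A, y \in B & adj x y].
Proof.
move=> /is_tubeP[[x xA] _] /is_tubeP[[y yB] _] dAB /is_tubeP[_ cU].
have /connectP[p] : connect (relA (A :|: B)) x y.
  by apply: cU; rewrite inE ?xA ?yB ?orbT.
elim: p x xA => [|z p IH] x xA /=.
  by move=> _ yx; move: (disjointFr dAB xA); rewrite -yx yB.
case/andP=> /and3P[_ zU xz] pz yE.
case: (boolP (z \in A)) => zA; first exact: IH zA pz yE.
by exists x, z; split=> //; move: zU; rewrite inE (negPf zA).
Qed.

End TubeTheory.

Definition weak_morph (Gam Del : cgraph) (f : Gam -> Del) : Prop :=
  forall x y, adj x y -> (f x == f y) || adj (f x) (f y).

Lemma imset_tube (Gam Del : cgraph) (f : Gam -> Del) (A : {set Gam}) :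
  weak_morph f -> is_tube A -> is_tube (f @: A).
Proof.
move=> wf /is_tubeP[[x xA] cA]; apply/is_tubeP; split.
  by exists (f x); apply: imset_f.
move=> _ _ /imsetP[y yA ->] /imsetP[z zA ->].
have /connectP[p] := cA _ _ yA zA.
elim: p y yA => [|w p IH] y yA /=; first by move=> _ ->.
case/andP=> /and3P[_ wA yw] pw zE; apply: connect_trans (IH w wA pw zE).
case/orP: (wf _ _ yw) => [/eqP->//|fyw]; apply: connect1.
by rewrite /= !imset_f.
Qed.

Section Induced.
Variables (Gam : cgraph) (G : tube Gam).

Lemma ind_adj_sym : symmetric (@ind_adj Gam G).
Proof. by move=> x y; rewrite /ind_adj adj_sym. Qed.

Lemma ind_adj_irr : irreflexive (@ind_adj Gam G).
Proof. by move=> x; rewrite /ind_adj adj_irr. Qed.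

Definition induced : cgraph := CGraph ind_adj_sym ind_adj_irr (tubeP G).

End Induced.

Section Contraction.
Variables (Gam : cgraph) (G : tube Gam).

Definition blocks : {set {set Gam}} := tset G |: [set [set v] | v in ~: G].

Definition contr_adj : rel {B : {set Gam} | B \in blocks} :=
  fun b c => (b != c) && is_tube (val b :|: val c).

Definition block_set (v : Gam) : {set Gam} := if v \in tset G then tset G else [set v].

Lemma block_setP v : block_set v \in blocks.
Proof.
rewrite /block_set /blocks; case: ifPn => vG; first by rewrite setU11.
by apply: setU1r; apply: imset_f; rewrite inE.
Qed.

Definition block (v : Gam) : {B : {set Gam} | B \in blocks} :=
  exist _ (block_set v) (block_setP v).

Lemma mem_block v : v \in val (block v).
Proof. by rewrite /= /block_set; case: ifP => //; rewrite inE. Qed.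

Lemma block_tube b : b \in blocks -> is_tube b.
Proof.
case/setU1P=> [->|/imsetP[v _ ->]]; [exact: tubeP | exact: is_tube1].
Qed.

Lemma mem_blockE v (b : {B : {set Gam} | B \in blocks}) :
  (v \in val b) = (block v == b).
Proof.
apply/idP/eqP => [|<-]; last exact: mem_block.
case: b => b bP vb; apply: val_inj; move: vb => /=; rewrite /block_set.
case/setU1P: (bP) => [->|/imsetP[w]]; first by move=> ->.
by rewrite inE => wG ->; rewrite inE => /eqP->; rewrite (negPf wG).
Qed.

Lemma block_surj b : exists v, block v == b.
Proof.
case/is_tubeP: (block_tube (valP b)) => -[v vb] _.
by exists v; rewrite -mem_blockE.
Qed.

Lemma block_eqE v w :
  (block v == block w) = (v == w) || (v \in tset G) && (w \in tset G).
Proof.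
rewrite -mem_blockE /= /block_set; case: ifPn => wG; last first.
  by rewrite inE andbF orbF.
by rewrite andbT; case: eqP => // ->.
Qed.

Lemma contr_adjE b c : contr_adj b c =
  (b != c) && [exists x, exists y, [&& block x == b, block y == c & adj x y]].
Proof.
rewrite /contr_adj; case: eqVneq => //= bc; apply/idP/'exists_'exists_and3P.
  have dbc : [disjoint val b & val c].
    apply/pred0P => x /=; apply/negP => /andP[]; rewrite !mem_blockE.
    by move=> /eqP xb /eqP xc; rewrite -xb -xc eqxx in bc.
  case/(is_tubeU_adj (block_tube (valP b)) (block_tube (valP c)) dbc) => x [y].
  by rewrite !mem_blockE => -[xb yc xy]; exists x, y.
case=> x [y [xb yc xy]].
apply: (@is_tubeU _ _ _ x y); rewrite ?mem_blockE ?xy ?orbT //;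
  exact: block_tube (valP _).
Qed.

Lemma contr_adj_sym : symmetric contr_adj.
Proof. by move=> b c; rewrite /contr_adj eq_sym setUC. Qed.

Lemma contr_adj_irr : irreflexive contr_adj.
Proof. by move=> b; rewrite /contr_adj eqxx. Qed.

Lemma block_adj x y : adj x y -> (block x == block y) || contr_adj (block x) (block y).
Proof.
move=> xy; rewrite contr_adjE; case: eqVneq => //= _.
by apply/'exists_'exists_and3P; exists x, y.
Qed.

Lemma contr_conn : connected_rel contr_adj.
Proof.
case/andP: (vert_conn Gam) => /card_gt0P[x _] /'forall_forallP cG.
apply/andP; split; first by apply/card_gt0P; exists (block x).
apply/'forall_forallP => b c.
case: (block_surj b) (block_surj c) => v /eqP<- [w /eqP<-].
have /connectP[p] := cG v w; elim: p v => [|z p IH] v /=; first by move=> _ ->.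
case/andP=> vz pz wE; apply: connect_trans (IH z pz wE).
by case/orP: (block_adj vz) => [/eqP->//|]; apply: connect1.
Qed.

Definition contr : cgraph := CGraph contr_adj_sym contr_adj_irr contr_conn.

Definition to_contr : Gam -> contr := block.

End Contraction.

Lemma to_contr_eq (Gam : cgraph) (G : tube Gam) (x y : Gam) :
  (to_contr G x == to_contr G y) = (x == y) || (x \in tset G) && (y \in tset G).
Proof. exact: block_eqE. Qed.

Record giso (Gam Del : cgraph) : Type := GIso {
  giso_fun :> Gam -> Del;
  giso_bij : bijective giso_fun;
  giso_adj : forall x y, adj (giso_fun x) (giso_fun y) = adj x y }.

Lemma giso_eq (Gam Del : cgraph) (f g : giso Gam Del) : f =1 g -> f = g.
Proof.
case: f g => f fb fa [g gb ga] /= /funext fg; subst g.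
by rewrite (Prop_irrelevance fb gb) (Prop_irrelevance fa ga).
Qed.

Definition giso_id (Gam : cgraph) : giso Gam Gam :=
  @GIso Gam Gam id (Bijective (frefl _) (frefl _)) (fun _ _ => erefl).

Definition giso_comp (Gam Del Eps : cgraph) (g : giso Del Eps) (f : giso Gam Del) :
  giso Gam Eps :=
  @GIso Gam Eps (g \o f) (bij_comp (giso_bij g) (giso_bij f))
    (fun x y => etrans (giso_adj g _ _) (giso_adj f _ _)).

(* [p] exhibits [Q] as the quotient graph of [Gam] by the fibres of [p]. *)
Definition gquot (Gam Q : cgraph) (p : Gam -> Q) : Prop :=
  (forall b, exists x, p x == b) /\
  (forall b c, adj b c =
    (b != c) && [exists x, exists y, [&& p x == b, p y == c & adj x y]]).

Section QuotIso.
Variables (Gam A B : cgraph) (p : Gam -> A) (r : Gam -> B).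
Hypotheses (qp : gquot p) (qr : gquot r).
Hypothesis pr : forall x y, (p x == p y) = (r x == r y).

Definition quot_iso_fun (a : A) : B := r (xchoose (qp.1 a)).

Lemma quot_iso_funE x : quot_iso_fun (p x) = r x.
Proof. by apply/eqP; rewrite -pr; exact: (xchooseP (qp.1 (p x))). Qed.

Lemma quot_iso_bij : bijective quot_iso_fun.
Proof.
exists (fun b => p (xchoose (qr.1 b))).
  move=> a; have [x /eqP<-] := qp.1 a; rewrite quot_iso_funE.
  by apply/eqP; rewrite pr (eqP (xchooseP (qr.1 (r x)))).
by move=> b; rewrite quot_iso_funE (eqP (xchooseP (qr.1 b))).
Qed.

Lemma quot_iso_adj a b : adj (quot_iso_fun a) (quot_iso_fun b) = adj a b.
Proof.
have [x /eqP<-] := qp.1 a; have [y /eqP<-] := qp.1 b.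
rewrite !quot_iso_funE qp.2 qr.2 pr; congr (_ && _).
by apply: eq_existsb => u; apply: eq_existsb => v; rewrite !pr.
Qed.

(* The isomorphism [A -> B] with [p x |-> r x]. *)
Definition quot_iso : giso A B := GIso quot_iso_bij quot_iso_adj.

End QuotIso.

Lemma gquot_giso (Gam Del : cgraph) (f : giso Gam Del) : gquot f.
Proof.
case: (giso_bij f) => g fK gK; split=> [b|b c]; first by exists (g b); rewrite gK.
apply/idP/andP => [bc|[_ /'exists_'exists_and3P[x [y [/eqP<- /eqP<-]]]]].
  split; first by apply: contraTneq bc => ->; rewrite adj_irr.
  apply/'exists_'exists_and3P; exists (g b), (g c).
  by rewrite !gK -(giso_adj f) !gK.
by rewrite giso_adj.
Qed.

Lemma gquot_id (Gam : cgraph) : gquot (@id Gam).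
Proof. exact: gquot_giso (giso_id Gam). Qed.

Lemma gquot_contr (Gam : cgraph) (G : tube Gam) : gquot (to_contr G).
Proof. by split; [exact: block_surj | exact: contr_adjE]. Qed.

Lemma gquot_comp (Gam A B : cgraph) (r : A -> B) (p : Gam -> A) :
  gquot r -> gquot p -> gquot (r \o p).
Proof.
move=> qr qp; split=> [b|b c].
  have [a /eqP<-] := qr.1 b; have [x /eqP<-] := qp.1 a.
  by exists x; rewrite /=.
rewrite qr.2; case: eqVneq => //= bc.
apply/'exists_'exists_and3P/'exists_'exists_and3P.
  case=> u [v [ub vc]]; rewrite qp.2.
  case/andP=> _ /'exists_'exists_and3P[x [y [/eqP xu /eqP yv xy]]].
  by exists x, y; rewrite xu yv.
case=> x [y [xb yc xy]]; exists (p x), (p y); split=> //.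
rewrite qp.2; apply/andP; split.
  by apply: contra_neq bc => pxy; rewrite -(eqP xb) -(eqP yc) pxy.
by apply/'exists_'exists_and3P; exists x, y.
Qed.

Lemma gquot_weak (Gam A : cgraph) (p : Gam -> A) : gquot p -> weak_morph p.
Proof.
move=> qp x y xy; rewrite qp.2; case: eqVneq => //= _.
by apply/'exists_'exists_and3P; exists x, y.
Qed.

Definition P1_adj : rel unit := fun _ _ => false.

Lemma P1_adj_conn : connected_rel P1_adj.
Proof.
apply/andP; split; first by rewrite card_unit.
by apply/'forall_forallP => -[] [].
Qed.

Definition P1 : cgraph :=
  @CGraph unit P1_adj (fun _ _ => erefl) (fun _ => erefl) P1_adj_conn.

Definition imset_map (S T : finType) (f : S -> T) (A : {set S}) (v : {v | v \in A}) :
  {w | w \in f @: A} := exist _ (f (val v)) (imset_f f (valP v)).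

Lemma imset_map_surj (S T : finType) (f : S -> T) (A : {set S}) b :
  exists a, @imset_map S T f A a == b.
Proof.
case: b => b bA; case/imsetP: (bA) => x xA bE.
by exists (exist _ x xA); apply/eqP/val_inj; rewrite /= bE.
Qed.

Definition tube1 (Gam : cgraph) (v : Gam) : tube Gam := Tube (is_tube1 v).

Definition tubeT (Gam : cgraph) : tube Gam := Tube (is_tubeT Gam).

(* The image of the tube [H] in the contraction of [G]. *)
Definition img_tube (Gam : cgraph) (G H : tube Gam) : tube (contr G) :=
  Tube (imset_tube (gquot_weak (gquot_contr G)) (tubeP H)).

Definition giso_tube (Gam Del : cgraph) (f : giso Gam Del) (G : tube Gam) : tube Del :=
  Tube (imset_tube (gquot_weak (gquot_giso f)) (tubeP G)).

Definition pre_set (Gam : cgraph) (H : tube Gam) (G : {set Gam}) : {set induced H} :=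
  [set v | val v \in G].

Lemma pre_tube_proof (Gam : cgraph) (H : tube Gam) (G : {set Gam}) :
  is_tube G -> G \subset H -> is_tube (pre_set H G).
Proof.
case/is_tubeP=> -[x xG] cG sGH; apply/is_tubeP; split.
  by exists (exist _ x (subsetP sGH x xG)); rewrite inE.
case=> y yH [z zH]; rewrite !inE /= => yG zG.
have /connectP[p] := cG _ _ yG zG.
elim: p y yH yG => [|w p IH] y yH yG /=.
  by move=> _ zy; move: zH zG; rewrite zy => zH _; rewrite (bool_irrelevance yH zH).
case/andP=> /and3P[_ wG yw] pw zE.
apply: connect_trans (IH w (subsetP sGH w wG) wG pw zE); apply: connect1.
by rewrite /= !inE yG wG.
Qed.

(* A subtube [G] of [H], as a tube of the graph induced on [H]. *)
Definition pre_tube (Gam : cgraph) (H G : tube Gam) (sGH : G \subset H) :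
  tube (induced H) := Tube (pre_tube_proof (tubeP G) sGH).

Section GisoFunctoriality.
Variables (Gam Del : cgraph) (f : giso Gam Del) (G : tube Gam).

Let f_inj : injective f. Proof. exact: bij_inj (giso_bij f). Qed.

Lemma giso_contr_fib x y : (to_contr G x == to_contr G y) =
  (to_contr (giso_tube f G) (f x) == to_contr (giso_tube f G) (f y)).
Proof. by rewrite !to_contr_eq /= (inj_eq f_inj) !(mem_imset _ _ f_inj). Qed.

Definition giso_contr : giso (contr G) (contr (giso_tube f G)) :=
  quot_iso (gquot_contr G)
    (gquot_comp (gquot_contr (giso_tube f G)) (gquot_giso f)) giso_contr_fib.

Lemma giso_ind_bij : bijective (@imset_map Gam Del f G).
Proof.
exists (fun b => xchoose (imset_map_surj b)).
  move=> a; have /eqP/(congr1 val)/= := xchooseP (imset_map_surj (imset_map f a)).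
  by move/f_inj/val_inj.
by move=> b; apply/eqP; exact: (xchooseP (imset_map_surj b)).
Qed.

Definition giso_ind : giso (induced G) (induced (giso_tube f G)) :=
  @GIso (induced G) (induced (giso_tube f G)) (@imset_map Gam Del f G)
    giso_ind_bij (fun x y => giso_adj f (val x) (val y)).

End GisoFunctoriality.

Section UnitIsos.
Variable Gam : cgraph.

Lemma contr1_fib (v x y : Gam) : (to_contr (tube1 v) x == to_contr (tube1 v) y) = (x == y).
Proof.
rewrite to_contr_eq /= !inE; case: (eqVneq x v) => [->|] /=; last by rewrite orbF.
by rewrite eq_sym orbb.
Qed.

Definition contr1_iso (v : Gam) : giso (contr (tube1 v)) Gam :=
  quot_iso (gquot_contr (tube1 v)) (gquot_id Gam) (contr1_fib v).

Lemma const_gquot (A : cgraph) : #|A| = 1 -> gquot (fun _ : A => tt : P1).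
Proof.
move=> cA; split=> [[]|[] []] //=.
by move/eqP/fintype1P: cA => [x _]; exists x.
Qed.

Lemma ind1_fib (v : Gam) (x y : induced (tube1 v)) : (x == y) = (tt == tt).
Proof.
rewrite eqxx -val_eqE /=.
by move: (valP x) (valP y); rewrite !inE => /eqP-> /eqP->; rewrite eqxx.
Qed.

Lemma card_ind1 (v : Gam) : #|induced (tube1 v)| = 1.
Proof. by rewrite card_sig -(cards1 v); apply: eq_card => x; rewrite !inE. Qed.

Definition ind1_iso (v : Gam) : giso (induced (tube1 v)) P1 :=
  quot_iso (gquot_id (induced (tube1 v))) (const_gquot (card_ind1 v)) (@ind1_fib v).

Lemma contrT_all (x y : contr (tubeT Gam)) : x = y.
Proof.
have [u /eqP<-] := block_surj x; have [v /eqP<-] := block_surj y.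
by apply/eqP; rewrite to_contr_eq /= !inE orbT.
Qed.

Lemma contrT_fib (x y : contr (tubeT Gam)) : (x == y) = (tt == tt).
Proof. by rewrite (contrT_all x y) !eqxx. Qed.

Lemma card_contrT : #|contr (tubeT Gam)| = 1.
Proof.
apply/eqP/fintype1P.
case/andP: (vert_conn (contr (tubeT Gam))) => /card_gt0P[x _] _.
by exists x => y; apply: contrT_all.
Qed.

Definition contrT_iso : giso (contr (tubeT Gam)) P1 :=
  quot_iso (gquot_id _) (const_gquot card_contrT) contrT_fib.

Lemma indT_bij : bijective (val : induced (tubeT Gam) -> Gam).
Proof.
exists (fun x => exist _ x (in_setT x)) => //.
by move=> x; apply: val_inj.
Qed.

Definition indT_iso : giso (induced (tubeT Gam)) Gam :=
  @GIso (induced (tubeT Gam)) Gam val indT_bij (fun _ _ => erefl).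

End UnitIsos.

Section NestedIsos.
Variables (Gam : cgraph) (G H : tube Gam).

Lemma mem_img_block (A : {set Gam}) : (G \subset A) || [disjoint G & A] ->
  forall x, (to_contr G x \in to_contr G @: A) = (x \in A).
Proof.
move=> GA x; apply/imsetP/idP => [[y yA /eqP]|xA]; last by exists x.
rewrite to_contr_eq => /orP[/eqP->//|/andP[xG yG]].
case/orP: GA => [/subsetP->//|dGA].
by rewrite (disjointFr dGA yG) in yA.
Qed.

Lemma gquot_imset_map : (G \subset H) || [disjoint G & H] ->
  @gquot (induced H) (induced (img_tube G H)) (@imset_map Gam (contr G) (to_contr G) H).
Proof.
move=> GH; split=> [b|b c]; first exact: imset_map_surj.
have -> : adj b c = adj (val b) (val c) by [].
rewrite (gquot_contr G).2 val_eqE; case: eqVneq => //= _.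
apply/'exists_'exists_and3P/'exists_'exists_and3P.
  case=> x [y [xb yc xy]].
  have xH : x \in tset H by rewrite -(mem_img_block GH) (eqP xb) (valP b).
  have yH : y \in tset H by rewrite -(mem_img_block GH) (eqP yc) (valP c).
  exists (exist _ x xH), (exist _ y yH); split=> //; by rewrite -val_eqE.
case=> x [y [xb yc xy]]; exists (val x), (val y).
by rewrite -(eqP xb) -(eqP yc) !eqxx.
Qed.

Lemma imset_map_fib (x y : induced H) :
  (imset_map (to_contr G) x == imset_map (to_contr G) y) =
  (to_contr G (val x) == to_contr G (val y)).
Proof. by rewrite -val_eqE. Qed.

End NestedIsos.

Section SequentialIsos.
Variables (Gam : cgraph) (G H : tube Gam) (sGH : G \subset H).

Lemma contr_contr_fib x y :
  (to_contr (img_tube G H) (to_contr G x) == to_contr (img_tube G H) (to_contr G y)) =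
  (to_contr H x == to_contr H y).
Proof.
rewrite !to_contr_eq /= !mem_img_block ?sGH //.
case: eqVneq => //= _; apply: orb_idl => /andP[xG yG].
by rewrite !(subsetP sGH).
Qed.

(* (Gam/G)/(H/G) = Gam/H *)
Definition contr_contr_iso : giso (contr (img_tube G H)) (contr H) :=
  quot_iso (gquot_comp (gquot_contr (img_tube G H)) (gquot_contr G))
    (gquot_contr H) contr_contr_fib.

Lemma ind_contr_compat : (G \subset H) || [disjoint G & H].
Proof. by rewrite sGH. Qed.

Lemma ind_contr_fib (x y : induced H) :
  (imset_map (to_contr G) x == imset_map (to_contr G) y) =
  (to_contr (pre_tube sGH) x == to_contr (pre_tube sGH) y).
Proof. by rewrite imset_map_fib !to_contr_eq /= !inE val_eqE. Qed.

(* (Gam/G)|_(H/G) = (Gam|_H)/G *)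
Definition ind_contr_iso : giso (induced (img_tube G H)) (contr (pre_tube sGH)) :=
  quot_iso (gquot_imset_map ind_contr_compat) (gquot_contr (pre_tube sGH)) ind_contr_fib.

Lemma mem_pre_tube (x : induced (pre_tube sGH)) : val (val x) \in tset G.
Proof. by have := valP x; rewrite inE. Qed.

Definition ind_ind_fun (x : induced (pre_tube sGH)) : induced G :=
  exist _ (val (val x)) (mem_pre_tube x).

Lemma ind_ind_bij : bijective ind_ind_fun.
Proof.
have inH (x : induced G) : val x \in tset H by exact: (subsetP sGH) (valP x).
have inG (x : induced G) :
    exist (fun v => v \in tset H) (val x) (inH x) \in tset (pre_tube sGH).
  by rewrite inE /=; exact: valP x.
exists (fun x => exist _ (exist _ (val x) (inH x)) (inG x)).
  by move=> x; do 2!apply: val_inj.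
by move=> x; apply: val_inj.
Qed.

(* (Gam|_H)|_G = Gam|_G *)
Definition ind_ind_iso : giso (induced (pre_tube sGH)) (induced G) :=
  @GIso (induced (pre_tube sGH)) (induced G) ind_ind_fun ind_ind_bij (fun _ _ => erefl).

End SequentialIsos.

Section ParallelIsos.
Variables (Gam : cgraph) (G1 G2 : tube Gam) (dG : [disjoint G1 & G2]).

Lemma par_contr_fib x y :
  (to_contr (img_tube G2 G1) (to_contr G2 x) == to_contr (img_tube G2 G1) (to_contr G2 y)) =
  (to_contr (img_tube G1 G2) (to_contr G1 x) == to_contr (img_tube G1 G2) (to_contr G1 y)).
Proof.
rewrite !to_contr_eq /= !mem_img_block ?dG ?orbT // 1?disjoint_sym ?dG ?orbT //.
by rewrite -!orbA; congr orb; exact: orbC.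
Qed.

(* (Gam/G2)/G1 = (Gam/G1)/G2 *)
Definition par_contr_iso : giso (contr (img_tube G2 G1)) (contr (img_tube G1 G2)) :=
  quot_iso (gquot_comp (gquot_contr (img_tube G2 G1)) (gquot_contr G2))
    (gquot_comp (gquot_contr (img_tube G1 G2)) (gquot_contr G1)) par_contr_fib.

Lemma par_ind_compat : (G1 \subset G2) || [disjoint G1 & G2].
Proof. by rewrite dG orbT. Qed.

Lemma par_ind_fib (x y : induced G2) :
  (imset_map (to_contr G1) x == imset_map (to_contr G1) y) = (x == y).
Proof.
rewrite imset_map_fib to_contr_eq val_eqE.
by rewrite (disjointFl dG (valP x)) orbF.
Qed.

(* (Gam/G1)|_G2 = Gam|_G2 *)
Definition par_ind_iso : giso (induced (img_tube G1 G2)) (induced G2) :=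
  quot_iso (gquot_imset_map par_ind_compat) (gquot_id (induced G2)) par_ind_fib.

End ParallelIsos.

Section NonTrivialTubes.
Implicit Types Gam Del : cgraph.

Definition ntube Gam : finType := {H : {set Gam} | is_tube H && (1 < #|H|)}.

Definition NTube Gam (H : {set Gam}) (h : is_tube H && (1 < #|H|)) : ntube Gam :=
  exist (fun H : {set Gam} => is_tube H && (1 < #|H|)) H h.

Definition sub_fin (S : finType) (A : {set S}) : finType := {v : S | v \in A}.

Lemma ntube_edge Gam (H : ntube Gam) : exists v w : sub_fin (val H), adj (val v) (val w).
Proof.
case: H => H /= /andP[/andP[_ /'forall_forallP cH] H1].
case/card_gt1P: H1 => v [w [vH wH vw]].
have /connectP[[|u p]] := cH (exist _ v vH) (exist _ w wH).
  by move=> _ /(congr1 val)/= wv; rewrite wv eqxx in vw.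
by case/andP=> vu _ _; exists (exist _ v vH), u.
Qed.

Lemma two_vertices_edge Gam : #|Gam| != 1 -> exists v w : Gam, adj v w.
Proof.
move=> G1; have GT : is_tube [set: Gam] && (1 < #|[set: Gam]|).
  rewrite is_tubeT cardsT; case/andP: (vert_conn Gam) => G0 _.
  by rewrite ltn_neqAle eq_sym G1.
by have [v [w]] := ntube_edge (NTube GT); exists (val v), (val w).
Qed.

Lemma ntube_void Gam (H : ntube Gam) : #|Gam| != 1.
Proof.
case: H => H /= /andP[_ H1]; apply: contraTneq (H1) => G1.
by rewrite -leqNgt -G1 max_card.
Qed.

Lemma giso_ntube_proof Gam Del (f : giso Gam Del) (H : ntube Gam) :
  is_tube (f @: val H) && (1 < #|f @: val H|).
Proof.
case/andP: (valP H) => tH H1; apply/andP; split.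
  exact: imset_tube (gquot_weak (gquot_giso f)) tH.
by rewrite card_imset //; exact: bij_inj (giso_bij f).
Qed.

Definition giso_ntube Gam Del (f : giso Gam Del) (H : ntube Gam) : ntube Del :=
  NTube (giso_ntube_proof f H).

End NonTrivialTubes.

Section NTubeInduced.
Variables (Gam : cgraph) (G : tube Gam) (H : ntube Gam).

Section Inside.
Hypothesis sHG : val H \subset G.

Lemma pre_ntube_proof :
  is_tube (pre_set G (val H)) && (1 < #|pre_set G (val H)|).
Proof.
case/andP: (valP H) => tH H1; rewrite pre_tube_proof //=.
have -> : #|pre_set G (val H)| = #|val H|.
  rewrite -(card_imset _ (val_inj : injective (val : induced G -> Gam))).
  apply: eq_card => v; apply/imsetP/idP => [[w]|vH]; first by rewrite inE => wH ->.
  by exists (exist _ v (subsetP sHG v vH)); rewrite ?inE.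
exact: H1.
Qed.

(* [H] as a tube of the graph induced on [G]. *)
Definition pre_ntube : ntube (induced G) := NTube pre_ntube_proof.

Definition pre_ntube_vert (v : sub_fin (val H)) : induced G :=
  exist _ (val v) (subsetP sHG _ (valP v)).

Lemma pre_ntube_mem (v : sub_fin (val H)) : pre_ntube_vert v \in val pre_ntube.
Proof. by rewrite inE; exact: valP v. Qed.

Definition pre_ntube_map (v : sub_fin (val H)) : sub_fin (val pre_ntube) :=
  exist _ (pre_ntube_vert v) (pre_ntube_mem v).

Lemma pre_ntube_surj (w : sub_fin (val pre_ntube)) : exists v, pre_ntube_map v == w.
Proof.
have wH : val (val w) \in val H by have := valP w; rewrite inE.
by exists (exist (fun v => v \in val H) _ wH); apply/eqP; do 2!apply: val_inj.
Qed.

End Inside.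

Section Outside.
Hypothesis nHG : ~~ (val H \subset G).

Lemma img_ntube_proof :
  is_tube (to_contr G @: val H) && (1 < #|to_contr G @: val H|).
Proof.
case/andP: (valP H) => tH /card_gt1P[v [w [vH wH vw]]].
rewrite (imset_tube (gquot_weak (gquot_contr G)) tH) /=.
case/subsetPn: nHG => u uH uG.
have [z zH uz] : exists2 z, z \in val H & u != z.
  by case: (eqVneq u v) => [->|]; [exists w | exists v].
apply/card_gt1P; exists (to_contr G u), (to_contr G z); rewrite !imset_f //.
by split=> //; rewrite to_contr_eq (negPf uz) (negPf uG).
Qed.

(* The image of [H] in the contraction of [G]. *)
Definition img_ntube : ntube (contr G) := NTube img_ntube_proof.

End Outside.
End NTubeInduced.

Record category : Type := Category {
  obj :> Type;
  hom : obj -> obj -> Type;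
  idm : forall A, hom A A;
  cmp : forall A B C, hom B C -> hom A B -> hom A C;
  cmpA : forall A B C D (h : hom C D) (g : hom B C) (f : hom A B),
    cmp h (cmp g f) = cmp (cmp h g) f;
  cmp1l : forall A B (f : hom A B), cmp (idm B) f = f;
  cmp1r : forall A B (f : hom A B), cmp f (idm A) = f }.
Arguments hom {c}.
Arguments idm {c}.
Arguments cmp {c A B C}.

Declare Scope cat_scope.
Delimit Scope cat_scope with cat.
Local Open Scope cat_scope.
Notation "g \c f" := (cmp g f) (at level 50, left associativity) : cat_scope.

Record smcat : Type := SMCat {
  sm_cat :> category;
  tensor : sm_cat -> sm_cat -> sm_cat;
  tensor_hom : forall A B C D : sm_cat, hom A C -> hom B D -> hom (tensor A B) (tensor C D);
  unit_ob : sm_cat;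
  associator : forall A B C : sm_cat, hom (tensor (tensor A B) C) (tensor A (tensor B C));
  associator_inv : forall A B C : sm_cat, hom (tensor A (tensor B C)) (tensor (tensor A B) C);
  lunitor : forall A : sm_cat, hom (tensor unit_ob A) A;
  lunitor_inv : forall A : sm_cat, hom A (tensor unit_ob A);
  runitor : forall A : sm_cat, hom (tensor A unit_ob) A;
  runitor_inv : forall A : sm_cat, hom A (tensor A unit_ob);
  braiding : forall A B : sm_cat, hom (tensor A B) (tensor B A);
  tensor_hom_id : forall A B : sm_cat, tensor_hom (idm A) (idm B) = idm (tensor A B);
  tensor_hom_cmp : forall (A B C A' B' C' : sm_cat)
      (g : hom B C) (f : hom A B) (g' : hom B' C') (f' : hom A' B'),
    tensor_hom (g \c f) (g' \c f') = tensor_hom g g' \c tensor_hom f f';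
  associatorK : forall A B C : sm_cat, associator_inv A B C \c associator A B C = idm _;
  associator_invK : forall A B C : sm_cat, associator A B C \c associator_inv A B C = idm _;
  lunitorK : forall A : sm_cat, lunitor_inv A \c lunitor A = idm _;
  lunitor_invK : forall A : sm_cat, lunitor A \c lunitor_inv A = idm _;
  runitorK : forall A : sm_cat, runitor_inv A \c runitor A = idm _;
  runitor_invK : forall A : sm_cat, runitor A \c runitor_inv A = idm _;
  associator_nat : forall (A B C A' B' C' : sm_cat)
      (f : hom A A') (g : hom B B') (h : hom C C'),
    associator A' B' C' \c tensor_hom (tensor_hom f g) h = tensor_hom f (tensor_hom g h) \c associator A B C;
  lunitor_nat : forall (A A' : sm_cat) (f : hom A A'),
    lunitor A' \c tensor_hom (idm unit_ob) f = f \c lunitor A;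
  runitor_nat : forall (A A' : sm_cat) (f : hom A A'),
    runitor A' \c tensor_hom f (idm unit_ob) = f \c runitor A;
  braiding_nat : forall (A B A' B' : sm_cat) (f : hom A A') (g : hom B B'),
    braiding A' B' \c tensor_hom f g = tensor_hom g f \c braiding A B;
  pentagon : forall A B C D : sm_cat,
    associator A B (tensor C D) \c associator (tensor A B) C D =
    tensor_hom (idm A) (associator B C D) \c associator A (tensor B C) D \c tensor_hom (associator A B C) (idm D);
  triangle : forall A B : sm_cat,
    tensor_hom (idm A) (lunitor B) \c associator A unit_ob B = tensor_hom (runitor A) (idm B);
  hexagon : forall A B C : sm_cat,
    associator B C A \c braiding A (tensor B C) \c associator A B C =
    tensor_hom (idm B) (braiding A C) \c associator B A C \c tensor_hom (braiding A B) (idm C);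
  braiding_sym : forall A B : sm_cat, braiding B A \c braiding A B = idm (tensor A B) }.
Arguments tensor {s}.
Arguments tensor_hom {s A B C D}.
Arguments unit_ob {s}.
Arguments associator {s}.
Arguments associator_inv {s}.
Arguments lunitor {s}.
Arguments runitor {s}.
Arguments braiding {s}.
Notation "A \ot B" := (tensor A B) (at level 40, left associativity) : cat_scope.
Notation "f \otm g" := (tensor_hom f g) (at level 40, left associativity) : cat_scope.

Record cartesian : Type := Cartesian {
  cart_cat :> category;
  prod_ob : cart_cat -> cart_cat -> cart_cat;
  pr1 : forall A B : cart_cat, hom (prod_ob A B) A;
  pr2 : forall A B : cart_cat, hom (prod_ob A B) B;
  pairing : forall X A B : cart_cat, hom X A -> hom X B -> hom X (prod_ob A B);
  terminal : cart_cat;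
  bang : forall X : cart_cat, hom X terminal;
  pr1_pair : forall (X A B : cart_cat) (f : hom X A) (g : hom X B),
    pr1 A B \c pairing f g = f;
  pr2_pair : forall (X A B : cart_cat) (f : hom X A) (g : hom X B),
    pr2 A B \c pairing f g = g;
  pair_ext : forall (X A B : cart_cat) (f g : hom X (prod_ob A B)),
    pr1 A B \c f = pr1 A B \c g -> pr2 A B \c f = pr2 A B \c g -> f = g;
  bang_ext : forall (X : cart_cat) (f g : hom X terminal), f = g }.

Section CartesianMonoidal.
Variable C : cartesian.
Local Notation p1 := (@pr1 C _ _).
Local Notation p2 := (@pr2 C _ _).
Local Notation "<< f , g >>" := (@pairing C _ _ _ f g).

Definition cart_tensm (A B A' B' : C) (f : hom A A') (g : hom B B') :
  hom (prod_ob A B) (prod_ob A' B') := << f \c p1, g \c p2 >>.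
Definition cart_asc (X Y Z : C) : hom (prod_ob (prod_ob X Y) Z) (prod_ob X (prod_ob Y Z)) :=
  << p1 \c p1, << p2 \c p1, p2 >> >>.
Definition cart_asci (X Y Z : C) : hom (prod_ob X (prod_ob Y Z)) (prod_ob (prod_ob X Y) Z) :=
  << << p1, p1 \c p2 >>, p2 \c p2 >>.
Definition cart_luni (X : C) : hom X (prod_ob (terminal C) X) := << bang X, idm X >>.
Definition cart_runi (X : C) : hom X (prod_ob X (terminal C)) := << idm X, bang X >>.
Definition cart_brd (X Y : C) : hom (prod_ob X Y) (prod_ob Y X) := << p2, p1 >>.

Lemma pr1_pairA (W X A B : C) (f : hom X A) (g : hom X B) (h : hom A W) :
  h \c p1 \c << f, g >> = h \c f.
Proof. by rewrite -cmpA pr1_pair. Qed.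

Lemma pr2_pairA (W X A B : C) (f : hom X A) (g : hom X B) (h : hom B W) :
  h \c p2 \c << f, g >> = h \c g.
Proof. by rewrite -cmpA pr2_pair. Qed.

Local Ltac cart := rewrite /cart_tensm /cart_asc /cart_asci /cart_luni /cart_runi /cart_brd;
  repeat first [apply: pair_ext | apply: bang_ext];
  rewrite ?cmpA; rewrite ?(pr1_pair, pr2_pair, pr1_pairA, pr2_pairA, cmp1l, cmp1r, cmpA);
  rewrite ?(pr1_pair, pr2_pair, pr1_pairA, pr2_pairA, cmp1l, cmp1r, cmpA) //.

Definition cart_smcat : smcat.
Proof.
refine (@SMCat C (@prod_ob C) cart_tensm (terminal C) cart_asc cart_asci
  (fun X => p2) cart_luni (fun X => p1) cart_runi cart_brd
  _ _ _ _ _ _ _ _ _ _ _ _ _ _ _ _); intros; abstract cart.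
Defined.

End CartesianMonoidal.

Record gcoll (C : category) : Type := GColl {
  gcoll_ob :> cgraph -> C;
  gcoll_map : forall Gam Del : cgraph, giso Gam Del -> hom (gcoll_ob Del) (gcoll_ob Gam);
  gcoll_map_id : forall Gam : cgraph, gcoll_map (giso_id Gam) = idm (gcoll_ob Gam);
  gcoll_map_comp : forall (Gam Del Eps : cgraph) (g : giso Del Eps) (f : giso Gam Del),
    gcoll_map (giso_comp g f) = gcoll_map f \c gcoll_map g }.

(* The axioms are written on elements as in a concrete category, up to the
   canonical isomorphisms:
     ctr_unitr:  lam o_{v} Id = lam
     ctr_unitl:  Id o_Gam lam = lam
     ctr_par:    (lam o_G2 nu2) o_G1 nu1 = (lam o_G1 nu1) o_G2 nu2,
                 lam in P(Gam/G1/G2), nu2 in P(Gam|_G2), nu1 in P(Gam|_G1)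
     ctr_seq:    lam o_H (mu o_G nu) = (lam o_{H/G} mu) o_G nu,
                 lam in P(Gam/H), mu in P((Gam|_H)/G), nu in P(Gam|_G). *)
Record contractad (C : smcat) (P : gcoll C) : Type := Contractad {
  ctr_unit : hom unit_ob (P P1);
  ctr_comp : forall (Gam : cgraph) (G : tube Gam),
    hom (P (contr G) \ot P (induced G)) (P Gam);
  ctr_nat : forall (Gam Del : cgraph) (f : giso Gam Del) (G : tube Gam),
    gcoll_map P f \c ctr_comp (giso_tube f G) =
    ctr_comp G \c (gcoll_map P (giso_contr f G) \otm gcoll_map P (giso_ind f G));
  ctr_unitr : forall (Gam : cgraph) (v : Gam),
    ctr_comp (tube1 v) \c
      (gcoll_map P (contr1_iso v) \otm (gcoll_map P (ind1_iso v) \c ctr_unit)) =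
    runitor (P Gam);
  ctr_unitl : forall Gam : cgraph,
    ctr_comp (tubeT Gam) \c
      ((gcoll_map P (contrT_iso Gam) \c ctr_unit) \otm gcoll_map P (indT_iso Gam)) =
    lunitor (P Gam);
  ctr_par : forall (Gam : cgraph) (G1 G2 : tube Gam)
      (d12 : [disjoint G1 & G2]) (d21 : [disjoint G2 & G1]),
    ctr_comp G1 \c
      ((ctr_comp (img_tube G1 G2) \c (idm _ \otm gcoll_map P (par_ind_iso d12)))
         \otm idm (P (induced G1))) =
    ctr_comp G2 \c
      ((ctr_comp (img_tube G2 G1) \c
          (gcoll_map P (par_contr_iso d12) \otm gcoll_map P (par_ind_iso d21)))
         \otm idm (P (induced G2))) \c
      (associator_inv _ _ _ \c (idm (P (contr (img_tube G1 G2))) \otm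
         braiding (P (induced G2)) (P (induced G1))) \c associator _ _ _);
  ctr_seq : forall (Gam : cgraph) (G H : tube Gam) (sGH : G \subset H),
    ctr_comp H \c
      (idm (P (contr H)) \otm
         (ctr_comp (pre_tube sGH) \c (idm _ \otm gcoll_map P (ind_ind_iso sGH)))) =
    ctr_comp G \c
      ((ctr_comp (img_tube G H) \c
          (gcoll_map P (contr_contr_iso sGH) \otm gcoll_map P (ind_contr_iso sGH)))
         \otm idm (P (induced G))) \c
      associator_inv (P (contr H)) (P (contr (pre_tube sGH))) (P (induced G)) }.

Import GRing.Theory.
Local Open Scope ring_scope.
Local Open Scope quotient_scope.

Section QuotientSpace.
Variables (K : fieldType) (V : vectType K) (U : {vspace V}).

Definition vquot_rel : rel V := fun x y => x - y \in U.

Lemma vquot_relP : equiv_class_of vquot_rel.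
Proof.
split=> [x|x y|y x z]; rewrite /vquot_rel.
- by rewrite subrr mem0v.
- by rewrite -memvN opprB.
- by move=> xy yz; rewrite -(subrKA y) memvD.
Qed.

Definition vquot_equiv : equiv_rel V := EquivRelPack vquot_relP.

Definition vquot : Type := {eq_quot vquot_equiv}.

HB.instance Definition _ := Choice.on vquot.
HB.instance Definition _ : EqQuotient V vquot_equiv vquot := EqQuotient.on vquot.

Definition vq_proj (x : V) : vquot := \pi_vquot x.

Lemma vq_projP x y : vq_proj x = vq_proj y <-> x - y \in U.
Proof.
split=> [/eqmodP//|xy].
by apply/eqmodP.
Qed.

Lemma vq_reprK : cancel (repr : vquot -> V) vq_proj.
Proof. by move=> a; rewrite /vq_proj reprK. Qed.

Let add (a b : vquot) := vq_proj (repr a + repr b).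
Let opp (a : vquot) := vq_proj (- repr a).
Let scale (k : K) (a : vquot) := vq_proj (k *: repr a).

Lemma vq_reprB x : repr (vq_proj x) - x \in U.
Proof. by apply/vq_projP; rewrite vq_reprK. Qed.

Lemma vq_addE x y : add (vq_proj x) (vq_proj y) = vq_proj (x + y).
Proof. by apply/vq_projP; rewrite opprD addrACA memvD ?vq_reprB. Qed.

Lemma vq_oppE x : opp (vq_proj x) = vq_proj (- x).
Proof. by apply/vq_projP; rewrite -opprD memvN vq_reprB. Qed.

Lemma vq_scaleE k x : scale k (vq_proj x) = vq_proj (k *: x).
Proof. by apply/vq_projP; rewrite -scalerBr memvZ ?vq_reprB. Qed.

Lemma vq_ind (P : vquot -> Prop) : (forall x, P (vq_proj x)) -> forall a, P a.
Proof. by move=> h a; rewrite -[a]vq_reprK; apply: h. Qed.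

Lemma vq_addA : associative add.
Proof. by elim/vq_ind=> x; elim/vq_ind=> y; elim/vq_ind=> z; rewrite !vq_addE addrA. Qed.
Lemma vq_addC : commutative add.
Proof. by elim/vq_ind=> x; elim/vq_ind=> y; rewrite !vq_addE addrC. Qed.
Lemma vq_add0 : left_id (vq_proj 0) add.
Proof. by elim/vq_ind=> x; rewrite vq_addE add0r. Qed.
Lemma vq_addN : left_inverse (vq_proj 0) opp add.
Proof. by elim/vq_ind=> x; rewrite vq_oppE vq_addE addNr. Qed.

HB.instance Definition _ := GRing.isZmodule.Build vquot vq_addA vq_addC vq_add0 vq_addN.

Lemma vq_scaleA (a b : K) (v : vquot) : scale a (scale b v) = scale (a * b) v.
Proof. by elim/vq_ind: v => x; rewrite !vq_scaleE scalerA. Qed.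
Lemma vq_scale1 : left_id 1 scale.
Proof. by elim/vq_ind=> x; rewrite vq_scaleE scale1r. Qed.
Lemma vq_scaleDr : right_distributive scale +%R.
Proof.
move=> k; elim/vq_ind=> x; elim/vq_ind=> y.
by rewrite -[LHS]/(scale k (add _ _)) -[RHS]/(add _ _) vq_addE !vq_scaleE vq_addE scalerDr.
Qed.
Lemma vq_scaleDl v : {morph scale^~ v : a b / a + b}.
Proof.
move=> a b; elim/vq_ind: v => x.
by rewrite -[RHS]/(add _ _) !vq_scaleE vq_addE scalerDl.
Qed.

HB.instance Definition _ := GRing.Zmodule_isLmodule.Build K vquot
  vq_scaleA vq_scale1 vq_scaleDr vq_scaleDl.

Lemma vq_proj_linear : linear vq_proj.
Proof.
move=> k x y; rewrite -[RHS]/(add (scale k _) _).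
by rewrite vq_scaleE vq_addE.
Qed.

HB.instance Definition _ := GRing.isLinear.Build K V vquot *:%R vq_proj vq_proj_linear.

Lemma vq_proj_eq0 x : (vq_proj x == 0) = (x \in U).
Proof.
rewrite -(linear0 vq_proj).
by apply/eqP/idP => [/vq_projP|xU]; [rewrite subr0 | apply/vq_projP; rewrite subr0].
Qed.

Definition vq_lift (a : vquot) : V := repr a - projv U (repr a).

Lemma vq_liftE x : vq_lift (vq_proj x) = x - projv U x.
Proof.
rewrite /vq_lift; set a := repr _.
have := projv_id (vq_reprB x); rewrite linearB /= -/a => E.
by apply/eqP; rewrite subr_eq -addrA [- _ + _]addrC E addrC subrK.
Qed.

Lemma vq_liftK : cancel vq_lift vq_proj.
Proof.
elim/vq_ind=> x; rewrite vq_liftE; apply/vq_projP.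
by rewrite addrAC subrr add0r memvN memv_proj.
Qed.

Lemma vq_lift_memC a : vq_lift a \in (U^C)%VS.
Proof.
elim/vq_ind: a => x; rewrite vq_liftE.
rewrite -{1}(daddv_pi_add (capv_compl U) (w := x)) ?addv_complf ?memvf //.
by rewrite addrAC subrr add0r memv_pi.
Qed.

Lemma vq_lift_linear : linear vq_lift.
Proof.
move=> k; elim/vq_ind=> x; elim/vq_ind=> y.
by rewrite -linearP !vq_liftE linearP /= scalerBr opprD addrACA.
Qed.

Lemma vquot_vect_iso : Vector.axiom (\dim (U^C)%VS) vquot.
Proof.
have [f f_lin f_bij] := subvs_vect_iso (U^C)%VS.
exists (f \o vsproj (U^C)%VS \o vq_lift).
  by move=> k x y; rewrite /= vq_lift_linear linearP f_lin.
case: f_bij => g fK gK; exists (vq_proj \o vsval \o g) => [a|r] /=.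
  by rewrite fK vsprojK ?vq_lift_memC // vq_liftK.
rewrite vq_liftE -[RHS]gK; congr f; apply: (@subvs_inj _ _ (U^C)%VS).
have gC := subvsP (g r).
suff -> : projv U (vsval (g r)) = 0 by rewrite subr0 vsprojK.
have := daddv_pi_add (capv_compl U) (w := vsval (g r)).
rewrite addv_complf memvf => /(_ isT).
have dis : (U^C :&: U = 0)%VS by rewrite capvC capv_compl.
rewrite [X in _ + X](daddv_pi_id dis gC) => /eqP.
by rewrite -subr_eq0 addrK => /eqP.
Qed.

HB.instance Definition _ := Lmodule_hasFinDim.Build K vquot vquot_vect_iso.

End QuotientSpace.

Section QuotientMap.
Variables (K : fieldType) (V W : vectType K) (U : {vspace V}) (U' : {vspace W}).
Variable f : 'Hom(V, W).
Hypothesis fU : forall x, x \in U -> f x \in U'.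

Definition vq_map_fun (a : vquot U) : vquot U' := vq_proj U' (f (repr a)).

Lemma vq_map_funE x : vq_map_fun (vq_proj U x) = vq_proj U' (f x).
Proof. by apply/vq_projP; rewrite -linearB fU ?vq_reprB. Qed.

Lemma vq_map_linear : linear vq_map_fun.
Proof.
move=> k; elim/vq_ind=> x; elim/vq_ind=> y.
by rewrite -linearP !vq_map_funE !linearP.
Qed.

HB.instance Definition _ := GRing.isLinear.Build K _ _ *:%R vq_map_fun vq_map_linear.

(* The linear map [V / U -> W / U'] induced by [f] when [f] maps [U] into [U']. *)
Definition vq_map : 'Hom(vquot U, vquot U') := linfun vq_map_fun.

Lemma vq_mapE x : vq_map (vq_proj U x) = vq_proj U' (f x).
Proof. by rewrite lfunE /= vq_map_funE. Qed.

End QuotientMap.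
Arguments vq_map {K V W} U U' f.

Section VSpaces.
Variable K : fieldType.

Definition cst1 (S : finType) : {ffun S -> K^o} := [ffun _ => 1].

(* [K^S] modulo the line spanned by [(1, ..., 1)]. *)
Definition VS (S : finType) : vectType K := vquot <[cst1 S]>%VS.

Definition pull_ffun (S T : finType) (f : S -> T) (x : {ffun T -> K^o}) :
  {ffun S -> K^o} := [ffun s => x (f s)].

Lemma pull_ffun_linear (S T : finType) (f : S -> T) : linear (pull_ffun f).
Proof. by move=> k x y; apply/ffunP => s; rewrite !ffunE. Qed.

HB.instance Definition _ (S T : finType) (f : S -> T) :=
  GRing.isLinear.Build K _ _ *:%R (pull_ffun f) (pull_ffun_linear f).

Lemma pull_cst (S T : finType) (f : S -> T) x :
  x \in <[cst1 T]>%VS -> linfun (pull_ffun f) x \in <[cst1 S]>%VS.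
Proof.
case/vlineP=> k ->; rewrite lfunE /=; apply/vlineP; exists k.
by apply/ffunP => s; rewrite !ffunE.
Qed.

(* Pullback of functions along [f : S -> T]; restriction of coordinates when
   [f] is the inclusion of a subset. *)
Definition pull (S T : finType) (f : S -> T) : 'Hom(VS T, VS S) :=
  vq_map _ _ (linfun (pull_ffun f)).

Definition vcls (S : finType) (x : {ffun S -> K^o}) : VS S := vq_proj _ x.

Lemma pullE (S T : finType) (f : S -> T) x : pull f (vcls x) = vcls (pull_ffun f x).
Proof. by rewrite /pull (vq_mapE (@pull_cst S T f)) lfunE. Qed.

Lemma pull_inj (S T : finType) (f : S -> T) :
  (forall t, exists s, f s == t) -> lker (pull f) == 0%VS.
Proof.
move=> f_surj; rewrite -subv0; apply/subvP => a; rewrite memv_ker memv0.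
elim/vq_ind: a => x; rewrite -[vq_proj _ x]/(vcls x) pullE !vq_proj_eq0.
case/vlineP=> k /ffunP kE; apply/vlineP; exists k; apply/ffunP => t.
by have [s /eqP<-] := f_surj t; have := kE s; rewrite !ffunE.
Qed.

End VSpaces.

From mathcomp Require Import classical_sets.
Local Open Scope classical_set_scope.

Section ProjectiveSpace.
Variable K : fieldType.

Definition pspace (V : vectType K) : Type := {L : {vspace V} | \dim L == 1%N}.

Definition represents (V : vectType K) (x : V) (L : pspace V) : Prop :=
  val L = <[x]>%VS.

Lemma proj_map_proof (V W : vectType K) (f : 'Hom(V, W)) (f0 : lker f == 0%VS)
  (L : pspace V) : \dim (f @: val L)%VS == 1%N.
Proof.
rewrite limg_dim_eq; first exact: valP L.
by rewrite (eqP f0) capv0.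
Qed.

Definition proj_map (V W : vectType K) (f : 'Hom(V, W)) (f0 : lker f == 0%VS)
  (L : pspace V) : pspace W := exist _ (f @: val L)%VS (proj_map_proof f0 L).

Lemma pspace_eq (V : vectType K) (L M : pspace V) : val L = val M -> L = M.
Proof. by move=> LM; apply: val_inj. Qed.

Lemma represents_nz (V : vectType K) (x : V) L : represents x L -> x != 0.
Proof.
move=> xL; have := valP L; rewrite /= xL dim_vline.
by case: (x != 0).
Qed.

Lemma pline_proof (V : vectType K) (x : V) : x != 0 -> \dim <[x]>%VS == 1%N.
Proof. by move=> x0; rewrite dim_vline x0. Qed.

Definition pline (V : vectType K) (x : V) (x0 : x != 0) : pspace V :=
  exist _ <[x]>%VS (pline_proof x0).

Lemma represents_ex (V : vectType K) (L : pspace V) : exists x, represents x L.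
Proof.
exists (vpick (val L)); apply/esym/eqP; rewrite eqEdim.
rewrite -memvE memv_pick /= dim_vline vpick0 (eqP (valP L)).
by rewrite -dimv_eq0 (eqP (valP L)).
Qed.

Lemma represents_proj_map (V W : vectType K) (f : 'Hom(V, W)) (f0 : lker f == 0%VS) x L :
  represents x L -> represents (f x) (proj_map f0 L).
Proof. by rewrite /represents /= => ->; rewrite limg_line. Qed.

Lemma represents_scale (V : vectType K) (x y : V) L :
  represents x L -> represents y L -> exists2 c, c != 0 & y = c *: x.
Proof.
move=> xL yL; have /vlineP[c yE] : y \in <[x]>%VS by rewrite -xL yL memv_line.
exists c => //; apply: contraTneq (represents_nz yL) => c0.
by rewrite yE c0 scale0r eqxx.
Qed.

Lemma represents_inj (V : vectType K) (x : V) L M :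
  represents x L -> represents x M -> L = M.
Proof. by move=> xL xM; apply: pspace_eq; rewrite xL xM. Qed.

End ProjectiveSpace.

Section Multiprojective.
Variables (K : fieldType) (I : finType) (V : I -> vectType K).

(* [mhpoly d f]: [f] is a polynomial function on the product of the [V i],
   homogeneous of degree [d i] in the [i]-th variable.  Coordinate-free: these
   are generated by constants and linear functionals.  Below [K] is infinite, so
   polynomial functions and polynomials agree. *)
Inductive mhpoly : (I -> nat) -> ((forall i, V i) -> K) -> Prop :=
| mh_const c : mhpoly (fun _ => 0%N) (fun _ => c)
| mh_lin i (l : 'Hom(V i, K^o)) : mhpoly (fun j => (j == i) : nat) (fun x => l (x i))
| mh_add d f g : mhpoly d f -> mhpoly d g -> mhpoly d (fun x => f x + g x)
| mh_mul d e f g : mhpoly d f -> mhpoly e g ->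
    mhpoly (fun i => (d i + e i)%N) (fun x => f x * g x).

Definition mhpoly_map (d : I -> nat) (W : vectType K) (F : (forall i, V i) -> W) : Prop :=
  forall l : 'Hom(W, K^o), mhpoly d (fun x => l (F x)).

Definition reps (x : forall i, V i) (p : forall i, pspace (V i)) : Prop :=
  forall i, represents (x i) (p i).

Definition vanishes (f : (forall i, V i) -> K) (p : forall i, pspace (V i)) : Prop :=
  forall x, reps x p -> f x = 0.

Definition zclosed (A : set (forall i, pspace (V i))) : Prop :=
  exists S : set ((forall i, V i) -> K),
    (forall f, S f -> exists d, mhpoly d f) /\
    A = [set p | forall f, S f -> vanishes f p].

Definition zclosure (A : set (forall i, pspace (V i))) : set (forall i, pspace (V i)) :=
  smallest zclosed A.

Definition zirreducible (X : set (forall i, pspace (V i))) : Prop :=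
  X !=set0 /\
  forall A B, zclosed A -> zclosed B -> X `<=` A `|` B -> X `<=` A \/ X `<=` B.

Lemma mhpoly_eq d d' f : d =1 d' -> mhpoly d f -> mhpoly d' f.
Proof. by move=> /funext ->. Qed.

Lemma mhpoly_homog d f : mhpoly d f -> forall (c : I -> K) x,
  f (fun i => c i *: x i) = (\prod_i c i ^+ d i) * f x.
Proof.
elim=> {d f} [c|i l|d f g _ IHf _ IHg|d e f g _ IHf _ IHg] a x.
- by rewrite big1 ?mul1r // => i _; rewrite expr0.
- rewrite linearZ /= (bigD1 i) //= eqxx expr1 big1 ?mulr1 // => j /negPf->.
  by rewrite expr0.
- by rewrite IHf IHg mulrDr.
- rewrite IHf IHg mulrACA -big_split /=; congr (_ * _).
  by apply: eq_bigr => i _; rewrite exprD.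
Qed.

Lemma reps_ex p : exists x, reps x p.
Proof.
exists (fun i => projT1 (cid (represents_ex (p i)))) => i.
exact: projT2 (cid (represents_ex (p i))).
Qed.

Lemma reps_inj x p q : reps x p -> reps x q -> p = q.
Proof.
move=> xp xq; apply: functional_extensionality_dep => i.
exact: represents_inj (xp i) (xq i).
Qed.

Lemma mhpoly_reps d f p x y : mhpoly d f -> reps x p -> reps y p -> f x = 0 -> f y = 0.
Proof.
move=> df xp yp fx.
have cE i : exists c, y i = c *: x i.
  by have [c _ ->] := represents_scale (xp i) (yp i); exists c.
pose c i := projT1 (cid (cE i)).
have -> : y = fun i => c i *: x i.
  apply: functional_extensionality_dep => i; exact: projT2 (cid (cE i)).
by rewrite (mhpoly_homog df) fx mulr0.
Qed.

Lemma vanishesP d f p x : mhpoly d f -> reps x p -> vanishes f p <-> f x = 0.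
Proof.
move=> df xp; split=> [|fx y yp]; first exact.
exact: mhpoly_reps df xp yp fx.
Qed.

Lemma zclosed_bigI (T : Type) (D : set T) (F : T -> set (forall i, pspace (V i))) :
  (forall t, D t -> zclosed (F t)) -> zclosed (\bigcap_(t in D) F t).
Proof.
move=> FC.
exists [set f | (exists d, mhpoly d f) /\
   exists2 t, D t & forall p, F t p -> vanishes f p]; split; first by move=> f [].
apply/seteqP; split=> p /= pF.
  by move=> f [_ [t Dt]]; apply; exact: pF.
move=> t Dt; have [S [SP FE]] := FC t Dt; rewrite FE /= => f Sf.
apply: pF; split; first exact: SP.
by exists t => // q; rewrite FE; apply.
Qed.

Lemma zclosedT : zclosed setT.
Proof. by exists set0; split=> //; apply/seteqP; split=> // p _ f []. Qed.

Lemma zclosed_zclosure A : zclosed (zclosure A).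
Proof.
by apply: (@zclosed_bigI _ [set M | zclosed M /\ A `<=` M] id) => M /= [].
Qed.

Lemma sub_zclosure A : A `<=` zclosure A.
Proof. exact: sub_smallest. Qed.

Lemma zclosure_min A B : zclosed B -> A `<=` B -> zclosure A `<=` B.
Proof. exact: smallest_sub. Qed.

Lemma zirreducible_closure A : A !=set0 ->
  (forall B C, zclosed B -> zclosed C -> A `<=` B `|` C -> A `<=` B \/ A `<=` C) ->
  zirreducible (zclosure A).
Proof.
move=> [p Ap] irrA; split; first by exists p; apply: sub_zclosure.
move=> B C cB cC ABC.
have [AB|AC] := irrA B C cB cC (subset_trans (@sub_zclosure A) ABC).
  by left; apply: zclosure_min.
by right; apply: zclosure_min.
Qed.

End Multiprojective.

Section Substitution.
Variables (K : fieldType) (I J : finType) (V : I -> vectType K) (W : J -> vectType K).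
Variables (d : J -> I -> nat) (F : forall j, (forall i, V i) -> W j).
Hypothesis dF : forall j, mhpoly_map (d j) (F j).

Lemma mhpoly_subst e f : mhpoly e f ->
  mhpoly (fun i => \sum_j e j * d j i)%N (fun x => f (fun j => F j x)).
Proof.
elim=> {e f} [c|j l|e f g _ IHf _ IHg|e e' f g _ IHf _ IHg].
- apply: mhpoly_eq (mh_const _ c) => i.
  by rewrite big1 // => j _; rewrite mul0n.
- apply: mhpoly_eq (dF l) => i.
  rewrite (bigD1 j) //= eqxx mul1n big1 ?addn0 // => k /negPf->.
  by rewrite mul0n.
- exact: mh_add.
- apply: mhpoly_eq (mh_mul IHf IHg) => i.
  by rewrite -big_split /=; apply: eq_bigr => j _; rewrite mulnDl.
Qed.

Lemma zclosed_preim (phi : (forall i, pspace (V i)) -> forall j, pspace (W j)) :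
  (forall p x, reps x p -> reps (fun j => F j x) (phi p)) ->
  forall A, zclosed A -> zclosed (phi @^-1` A).
Proof.
move=> phiF A [S [SP ->]].
exists [set f | exists2 g, S g & f = fun x => g (fun j => F j x)]; split.
  move=> f [g Sg ->]; have [e eg] := SP g Sg.
  by eexists; exact: mhpoly_subst eg.
apply/seteqP; split=> p /= pS.
  move=> f [g Sg ->] x xp; exact: pS Sg _ (phiF _ _ xp).
move=> g Sg; have [e eg] := SP g Sg; have [x xp] := reps_ex p.
apply/(vanishesP eg (phiF _ _ xp)); apply: (pS (fun x => g (fun j => F j x))) => //.
by exists g.
Qed.

End Substitution.

Lemma mhpoly_proj (K : fieldType) (I : finType) (V : I -> vectType K) i
  (W : vectType K) (f : 'Hom(V i, W)) :
  mhpoly_map (fun j => (j == i) : nat) (fun x : forall i, V i => f (x i)).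
Proof.
move=> l; have := mh_lin (l \o f)%VF.
by congr mhpoly; apply: funext => x; rewrite lfunE.
Qed.

Lemma mhpoly_projid (K : fieldType) (I : finType) (V : I -> vectType K) i :
  mhpoly_map (fun j => (j == i) : nat) (fun x : forall i, V i => x i).
Proof. by move=> l; exact: mh_lin. Qed.

Lemma mhpoly_cst (K : fieldType) (I : finType) (V : I -> vectType K)
  (W : vectType K) (w : W) : mhpoly_map (fun=> 0%N) (fun _ : forall i, V i => w).
Proof. by move=> l; exact: mh_const. Qed.

Section ProjectiveVarieties.
Variable K : fieldType.

(* An irreducible Zariski-closed subset of a finite product of projective
   spaces, by the Segre embedding a projective variety. *)
Record projvar : Type := ProjVar {
  pv_idx : finType;
  pv_sp : pv_idx -> vectType K;
  pv_set : set (forall i, pspace (pv_sp i));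
  pv_closed : zclosed pv_set;
  pv_irr : zirreducible pv_set }.
Arguments pv_sp : clear implicits.
Arguments pv_set : clear implicits.

Definition pv_pt (X : projvar) : Type := {p | pv_set X p}.

Lemma pv_pt_eq X (p q : pv_pt X) : (forall i, sval p i = sval q i) -> p = q.
Proof.
case: p q => p pX [q qX] /= pq.
have {}pq : p = q by apply: functional_extensionality_dep.
by subst q; rewrite (Prop_irrelevance pX qX).
Qed.

(* Around each point [f] is given in coordinates by multihomogeneous polynomials
   [F], on the principal open set where [g] does not vanish. *)
Definition regular (X Y : projvar) (f : pv_pt X -> pv_pt Y) : Prop :=
  forall p : pv_pt X,
  exists (e : pv_idx X -> nat) (g : (forall i, pv_sp X i) -> K)
         (d : pv_idx Y -> pv_idx X -> nat)
         (F : forall j, (forall i, pv_sp X i) -> pv_sp Y j),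
  [/\ mhpoly e g,
      forall j, mhpoly_map (d j) (F j),
      ~ vanishes g (sval p) &
      forall (q : pv_pt X) x, reps x (sval q) -> g x != 0 ->
        reps (fun j => F j x) (sval (f q))].

Record pvmor (X Y : projvar) : Type := PVMor {
  pvfun :> pv_pt X -> pv_pt Y;
  pvfun_reg : regular pvfun }.

Lemma pvmor_eq X Y (f g : pvmor X Y) : f =1 g -> f = g.
Proof.
case: f g => f fr [g gr] /= /funext fg; subst g.
by rewrite (Prop_irrelevance fr gr).
Qed.

Lemma regular_global (X Y : projvar) (f : pv_pt X -> pv_pt Y)
    (d : pv_idx Y -> pv_idx X -> nat) (F : forall j, (forall i, pv_sp X i) -> pv_sp Y j) :
  (forall j, mhpoly_map (d j) (F j)) ->
  (forall (q : pv_pt X) x, reps x (sval q) -> reps (fun j => F j x) (sval (f q))) ->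
  regular f.
Proof.
move=> dF Ff p; exists (fun=> 0%N), (fun=> 1), d, F; split=> //.
- exact: mh_const.
- have [x xp] := reps_ex (sval p).
  by move=> /(_ x xp)/eqP; rewrite oner_eq0.
- by move=> q x xq _; exact: Ff.
Qed.

Lemma regular_id X : regular (@id (pv_pt X)).
Proof. by apply: (regular_global (fun j => @mhpoly_projid _ _ (pv_sp X) j)). Qed.

Lemma regular_comp X Y Z (g : pv_pt Y -> pv_pt Z) (f : pv_pt X -> pv_pt Y) :
  regular g -> regular f -> regular (g \o f).
Proof.
move=> gr fr p; have [e1 [h1 [d1 [F1 [e1h dF1 h1p fF1]]]]] := fr p.
have [e2 [h2 [d2 [F2 [e2h dF2 h2p gF2]]]]] := gr (f p).
have [x xp] := reps_ex (sval p).
have h1x : h1 x != 0 by apply/eqP => h1x; apply: h1p; apply/(vanishesP e1h xp).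
have fx := fF1 _ _ xp h1x.
have h2x : h2 (fun j => F1 j x) != 0.
  by apply/eqP => h2x; apply: h2p; apply/(vanishesP e2h fx).
have h2h := mhpoly_subst dF1 e2h.
exists (fun i => (e1 i + \sum_j e2 j * d1 j i)%N), (fun x => h1 x * h2 (fun j => F1 j x)),
  (fun k i => (\sum_j d2 k j * d1 j i)%N), (fun k x => F2 k (fun j => F1 j x)).
split.
- exact: mh_mul e1h h2h.
- by move=> k l; have := mhpoly_subst dF1 (dF2 k l).
- by move=> /(_ x xp)/eqP; rewrite mulf_eq0 (negPf h1x) (negPf h2x).
- move=> q y yq; rewrite mulf_eq0 negb_or => /andP[h1y h2y] /=.
  exact: gF2 (fF1 _ _ yq h1y) h2y.
Qed.

Definition pv_cat : category.
Proof.
refine (@Category projvar pvmor (fun X => PVMor (@regular_id X))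
  (fun X Y Z g f => PVMor (regular_comp (pvfun_reg g) (pvfun_reg f))) _ _ _);
  intros; abstract (exact: pvmor_eq).
Defined.

Section Product.
Variables X Y : projvar.

Definition prod_sp (k : pv_idx X + pv_idx Y) : vectType K :=
  match k with inl i => pv_sp X i | inr j => pv_sp Y j end.

Definition prod_fst (p : forall k, pspace (prod_sp k)) (i : pv_idx X) :
  pspace (pv_sp X i) := p (inl i).
Definition prod_snd (p : forall k, pspace (prod_sp k)) (j : pv_idx Y) :
  pspace (pv_sp Y j) := p (inr j).
Definition prod_pair (p : forall i, pspace (pv_sp X i)) (q : forall j, pspace (pv_sp Y j))
    (k : pv_idx X + pv_idx Y) : pspace (prod_sp k) :=
  match k with inl i => p i | inr j => q j end.
Definition prod_vpair (x : forall i, pv_sp X i) (y : forall j, pv_sp Y j)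
    (k : pv_idx X + pv_idx Y) : prod_sp k :=
  match k with inl i => x i | inr j => y j end.

Definition prod_set : set (forall k, pspace (prod_sp k)) :=
  [set p | pv_set X (prod_fst p) /\ pv_set Y (prod_snd p)].

Lemma prod_set_closed : zclosed prod_set.
Proof.
have c1 : zclosed (prod_fst @^-1` pv_set X).
  apply: (@zclosed_preim _ _ _ prod_sp (pv_sp X) _ _
    (fun i => @mhpoly_projid _ _ prod_sp (inl i))) (pv_closed X).
  by move=> p x xp i; exact: (xp (inl i)).
have c2 : zclosed (prod_snd @^-1` pv_set Y).
  apply: (@zclosed_preim _ _ _ prod_sp (pv_sp Y) _ _
    (fun i => @mhpoly_projid _ _ prod_sp (inr i))) (pv_closed Y).
  by move=> p x xp i; exact: (xp (inr i)).
have -> : prod_set = \bigcap_(b in [set: bool])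
    (if b then prod_fst @^-1` pv_set X else prod_snd @^-1` pv_set Y).
  apply/seteqP; split=> p /=; first by move=> [pX pY] [] _.
  by move=> pXY; split; [exact: (pXY true) | exact: (pXY false)].
by apply: zclosed_bigI => -[].
Qed.

Lemma slice1_closed p A : zclosed A -> zclosed (prod_pair p @^-1` A).
Proof.
have [x xp] := reps_ex p.
have dF (k : pv_idx X + pv_idx Y) : exists d : pv_idx Y -> nat,
    mhpoly_map d (fun y : forall j, pv_sp Y j => prod_vpair x y k).
  by case: k => k; eexists; [exact: mhpoly_cst | exact: mhpoly_projid].
apply: (zclosed_preim (fun k => projT2 (cid (dF k)))) => q y yq [k|k].
  exact: xp.
exact: yq.
Qed.

Lemma slice2_closed q A : zclosed A -> zclosed (prod_pair^~ q @^-1` A).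
Proof.
have [y yq] := reps_ex q.
have dF (k : pv_idx X + pv_idx Y) : exists d : pv_idx X -> nat,
    mhpoly_map d (fun x : forall i, pv_sp X i => prod_vpair x y k).
  by case: k => k; eexists; [exact: mhpoly_projid | exact: mhpoly_cst].
apply: (zclosed_preim (fun k => projT2 (cid (dF k)))) => p x xp [k|k].
  exact: xp.
exact: yq.
Qed.

Lemma prod_pairK p : prod_pair (prod_fst p) (prod_snd p) = p.
Proof. by apply: functional_extensionality_dep => -[]. Qed.

Lemma prod_set_irr : zirreducible prod_set.
Proof.
have [[p pX] irrX] := pv_irr X; have [[q qY] irrY] := pv_irr Y.
split; first by exists (prod_pair p q).
move=> A B cA cB XYAB.
pose XA C := \bigcap_(q in pv_set Y) (prod_pair^~ q @^-1` C).
have cXA C : zclosed C -> zclosed (XA C).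
  by move=> cC; apply: zclosed_bigI => t _; exact: slice2_closed.
have XAE C : pv_set X `<=` XA C -> prod_set `<=` C.
  by move=> XC r [rX rY]; rewrite -[r]prod_pairK; exact: (XC _ rX).
have [XXA|XXB] : pv_set X `<=` XA A \/ pv_set X `<=` XA B; [|by left; exact: XAE..|].
  apply: irrX; [exact: cXA..|] => r rX.
  by apply: irrY; [exact: slice1_closed..|] => s sY; exact: XYAB.
by right; exact: XAE.
Qed.

Definition pv_prod : projvar := ProjVar prod_set_closed prod_set_irr.

Definition pv_fst_fun (p : pv_pt pv_prod) : pv_pt X :=
  exist _ (prod_fst (sval p)) (svalP p).1.
Definition pv_snd_fun (p : pv_pt pv_prod) : pv_pt Y :=
  exist _ (prod_snd (sval p)) (svalP p).2.

Lemma pv_fst_reg : regular pv_fst_fun.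
Proof.
apply: (@regular_global pv_prod X _ _ _ (fun i => @mhpoly_projid _ _ prod_sp (inl i))).
by move=> q x xq i; exact: (xq (inl i)).
Qed.

Lemma pv_snd_reg : regular pv_snd_fun.
Proof.
apply: (@regular_global pv_prod Y _ _ _ (fun i => @mhpoly_projid _ _ prod_sp (inr i))).
by move=> q x xq i; exact: (xq (inr i)).
Qed.

Definition pv_fst : pvmor pv_prod X := PVMor pv_fst_reg.
Definition pv_snd : pvmor pv_prod Y := PVMor pv_snd_reg.

End Product.

Section Pairing.
Variables (Z X Y : projvar) (f : pvmor Z X) (g : pvmor Z Y).

Definition pv_pair_fun (p : pv_pt Z) : pv_pt (pv_prod X Y) :=
  exist _ (prod_pair (sval (f p)) (sval (g p))) (conj (svalP (f p)) (svalP (g p))).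

Lemma pv_pair_reg : regular pv_pair_fun.
Proof.
move=> p; have [e1 [h1 [d1 [F1 [e1h dF1 h1p fF1]]]]] := pvfun_reg f p.
have [e2 [h2 [d2 [F2 [e2h dF2 h2p gF2]]]]] := pvfun_reg g p.
have [x xp] := reps_ex (sval p).
exists (fun i => (e1 i + e2 i)%N), (fun x => h1 x * h2 x),
  (fun k => match k with inl i => d1 i | inr j => d2 j end),
  (fun k x => @prod_vpair X Y (fun i => F1 i x) (fun j => F2 j x) k).
split; first exact: mh_mul e1h e2h.
- by move=> [i|j]; [exact: dF1 | exact: dF2].
- move=> /(_ x xp)/eqP; rewrite mulf_eq0 => /orP[]/eqP h0.
    by apply: h1p; apply/(vanishesP e1h xp).
  by apply: h2p; apply/(vanishesP e2h xp).
- move=> q y yq; rewrite mulf_eq0 negb_or => /andP[h1y h2y] [k|k] /=.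
    exact: (fF1 q y yq h1y).
  exact: (gF2 q y yq h2y).
Qed.

Definition pv_pair : pvmor Z (pv_prod X Y) := PVMor pv_pair_reg.

End Pairing.

Definition void_sp (i : void) : vectType K := match i with end.

Lemma pt_set_irr : zirreducible [set: forall i, pspace (void_sp i)].
Proof.
pose p0 (i : void) : pspace (void_sp i) := match i with end.
have pE (p : forall i, pspace (void_sp i)) : p = p0.
  by apply: functional_extensionality_dep => -[].
split; first by exists p0.
move=> A B _ _ AB.
have [Ap|Bp] := AB p0 I; [left|right]; by move=> p _; rewrite (pE p).
Qed.

Definition pv_pnt : projvar := ProjVar (@zclosedT _ _ void_sp) pt_set_irr.

Definition pnt_pt : pv_pt pv_pnt := exist _ (fun i : void => match i with end) I.

Lemma pv_bang_reg X : regular (fun _ : pv_pt X => pnt_pt).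
Proof.
apply: (@regular_global X pv_pnt _ (fun i : void => match i with end)
  (fun i : void => match i with end)) => [[]|q x _ []].
Qed.

Definition pv_bang (X : projvar) : pvmor X pv_pnt := PVMor (@pv_bang_reg X).

Definition pv_cart : cartesian.
Proof.
refine (@Cartesian pv_cat pv_prod pv_fst pv_snd pv_pair pv_pnt pv_bang _ _ _ _).
- abstract (by move=> X A B f g; apply: pvmor_eq => p; apply: pv_pt_eq).
- abstract (by move=> X A B f g; apply: pvmor_eq => p; apply: pv_pt_eq).
- abstract (by move=> X A B f g fg1 fg2;
    apply: pvmor_eq => p; apply: pv_pt_eq => -[i|j];
    [exact: (congr1 (fun h : pvmor _ _ => sval (h p) i) fg1)
    |exact: (congr1 (fun h : pvmor _ _ => sval (h p) j) fg2)]).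
- abstract (by move=> X f g; apply: pvmor_eq => p; apply: pv_pt_eq => -[]).
Defined.

Definition pv_smcat : smcat := cart_smcat pv_cart.

End ProjectiveVarieties.

Import Order.TTheory Num.Theory.

Section Wonderful.
Variable K : numClosedFieldType.
Implicit Types Gam Del : cgraph.

Definition tube_sp Gam (H : ntube Gam) : vectType K := VS K (sub_fin (val H)).

(* Complement of the hyperplanes [x v = x w], for [v -- w] an edge; a line in
   [VS K Gam] is given by any function [x] whose class spans it. *)
Definition Mopen Gam : set (pspace (VS K Gam)) :=
  [set L | forall x : {ffun Gam -> K^o}, represents (vcls x) L ->
    forall v w, adj v w -> x v != x w].

Definition Mimage Gam : set (forall H : ntube Gam, pspace (tube_sp H)) :=
  [set p | exists2 L, Mopen L &
    forall H : ntube Gam, val (p H) = (pull K (val : sub_fin (val H) -> Gam) @: val L)%VS].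

(* For a one-vertex graph there is no non-trivial tube, and [setT] is a point. *)
Definition Mbar_set Gam : set (forall H : ntube Gam, pspace (tube_sp H)) :=
  if #|Gam| == 1%N then setT else zclosure (@Mimage Gam).

Definition generic Gam (x : {ffun Gam -> K^o}) : Prop :=
  forall v w, adj v w -> x v != x w.

Definition res Gam (x : {ffun Gam -> K^o}) (H : ntube Gam) : tube_sp H :=
  vcls (pull_ffun (val : sub_fin (val H) -> Gam) x).

Lemma vcls_linear (S : finType) : linear (@vcls K S).
Proof. exact: vq_proj_linear. Qed.

Lemma res_line Gam (x y : {ffun Gam -> K^o}) t H : res (x + t *: y) H = res x H + t *: res y H.
Proof. by rewrite /res addrC linearP /= vcls_linear addrC. Qed.

Lemma vcls_eq0 (S : finType) (x : {ffun S -> K^o}) :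
  vcls x = 0 -> forall s t, x s = x t.
Proof.
move/eqP; rewrite vq_proj_eq0 => /vlineP[k ->] s t.
by rewrite !ffunE.
Qed.

Lemma generic_res_nz Gam (x : {ffun Gam -> K^o}) (H : ntube Gam) :
  generic x -> res x H != 0.
Proof.
move=> gx; have [v [w vw]] := ntube_edge H; apply: contra_neq (gx _ _ vw).
by move/vcls_eq0 => /(_ v w); rewrite !ffunE.
Qed.

Definition res_pt_of Gam (x : {ffun Gam -> K^o}) (gx : generic x) (H : ntube Gam) :
  pspace (tube_sp H) := pline (generic_res_nz H gx).

Lemma MimageP Gam p : #|Gam| != 1%N ->
  @Mimage Gam p <-> exists2 x, generic x & reps (res x) p.
Proof.
move=> G1; split=> [[L LM pL]|[x gx xp]].
  have [a] := represents_ex L; elim/vq_ind: a => x xL.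
  exists x; first exact: LM xL.
  move=> H; rewrite /represents pL xL limg_line.
  by congr (<[_]>)%VS; exact: pullE.
have x0 : vcls x != 0.
  have [v [w vw]] := two_vertices_edge G1.
  by apply: contra_neq (gx _ _ vw) => /vcls_eq0.
exists (pline x0) => [y yx v w vw|H]; last first.
  rewrite (xp H) /= limg_line; congr (<[_]>)%VS.
  by rewrite pullE.
have [c c0 yE] := represents_scale (erefl : represents (vcls x) (pline x0)) yx.
have /eqP : vcls (y - c *: x) = 0.
  by rewrite addrC -scaleNr vcls_linear yE scaleNr addNr.
move/eqP/vcls_eq0/(_ v w); rewrite !ffunE => yxE.
apply: contra_neq (gx _ _ vw) => yvw; move: yxE; rewrite yvw => /addrI/oppr_inj.
exact: (mulfI c0).
Qed.

Lemma mhpoly_line (I : finType) (V : I -> vectType K) d (f : (forall i, V i) -> K) a b :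
  mhpoly d f -> exists P : {poly K}, forall t : K, f (fun i => a i + t *: b i) = P.[t].
Proof.
elim=> {d f} [c|i l|d f g _ [P fP] _ [Q gQ]|d e f g _ [P fP] _ [Q gQ]].
- by exists c%:P => t; rewrite hornerC.
- exists ((l (a i) : K)%:P + (l (b i) : K)%:P * 'X) => t.
  by rewrite linearD linearZ /= !hornerE mulrC.
- by exists (P + Q) => t; rewrite hornerD fP gQ.
- by exists (P * Q) => t; rewrite hornerM fP gQ.
Qed.

Lemma generic_line Gam (x y : {ffun Gam -> K^o}) : generic x ->
  exists2 P : {poly K}, P != 0 & forall t, P.[t] != 0 -> generic (x + t *: y).
Proof.
move=> gx.
exists (\prod_(e : Gam * Gam | adj e.1 e.2)
   ((x e.1 - x e.2 : K)%:P + (y e.1 - y e.2 : K)%:P * 'X)).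
  apply/prodf_neq0 => -[v w] /= vw.
  apply/eqP => /(congr1 (horner^~ 0)); rewrite !hornerE ?mulr0 ?addr0.
  by move/eqP; rewrite subr_eq0; apply/negP; exact: gx.
move=> t; rewrite horner_prod => /prodf_neq0 Pt v w vw.
have := Pt (v, w) vw; rewrite /= !hornerE !ffunE /=.
apply: contra_neq => E; apply/eqP.
rewrite mulrBl addrACA -opprD subr_eq0.
by rewrite [_ * t]mulrC [X in _ == _ + X]mulrC; apply/eqP.
Qed.

Lemma generic_ex Gam : exists x : {ffun Gam -> K^o}, generic x.
Proof.
exists [ffun v => (enum_rank v)%:R] => v w vw; rewrite !ffunE.
apply: contraTneq vw => /eqP; rewrite eqr_nat => /eqP/val_inj/enum_rank_inj ->.
by rewrite adj_irr.
Qed.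

Lemma Mbar_closed Gam : zclosed (@Mbar_set Gam).
Proof. by rewrite /Mbar_set; case: ifP => _; [exact: zclosedT | exact: zclosed_zclosure]. Qed.

Lemma Mbar_irr Gam : zirreducible (@Mbar_set Gam).
Proof.
rewrite /Mbar_set; case: eqVneq => [G1|G1].
  have noH (H : ntube Gam) : False by move: (ntube_void H); rewrite G1.
  pose p0 (H : ntube Gam) : pspace (tube_sp H) := match noH H with end.
  have pE (p : forall H : ntube Gam, pspace (tube_sp H)) : p = p0.
    by apply: functional_extensionality_dep => H; case: (noH H).
  split; first by exists p0.
  move=> A B _ _ AB.
  by have [Ap|Bp] := AB p0 Logic.I; [left|right]; move=> p _; rewrite (pE p).
apply: zirreducible_closure.
  have [x gx] := generic_ex Gam.
  by exists (res_pt_of gx); apply/MimageP => //; exists x => // H.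
move=> A B [SA [SAP AE]] [SB [SBP BE]] MAB.
have notin (S : set ((forall H : ntube Gam, tube_sp H) -> K)) C :
    (forall f, S f -> exists d, mhpoly d f) ->
    C = [set p | forall f, S f -> vanishes f p] -> ~ @Mimage Gam `<=` C ->
    exists f d x, [/\ S f, mhpoly d f, generic x & f (res x) != 0].
  move=> SP -> /existsNP[p /not_implyP[/(MimageP p G1)[x gx xp]]] /existsNP[f].
  move=> /not_implyP[Sf fp]; have [d df] := SP f Sf.
  exists f, d, x; split=> //; apply/eqP => fx; apply: fp.
  by apply/(vanishesP df xp).
case: (pselect (@Mimage Gam `<=` A)) => [|MA]; first by left.
case: (pselect (@Mimage Gam `<=` B)) => [|MB]; first by right.
exfalso.
have [f [d [x [Af df gx fx]]]] := notin SA A SAP AE MA.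
have [g [e [y [Bg eg gy gyn]]]] := notin SB B SBP BE MB.
have [P fP] := mhpoly_line (res x) (res (y - x)) df.
have [Q gQ] := mhpoly_line (res x) (res (y - x)) eg.
have resE t : (fun H => res x H + t *: res (y - x) H) = res (x + t *: (y - x)).
  by apply: functional_extensionality_dep => H; rewrite res_line.
have [R R0 Rg] := generic_line (y - x) gx.
have PQR0 : P * Q * R != 0.
  rewrite !mulf_neq0 //.
    by apply: contra_neq fx => P0; have := fP 0; rewrite resE P0 scale0r addr0 horner0.
  apply: contra_neq gyn => Q0; have := gQ 1.
  by rewrite resE Q0 scale1r addrCA subrr addr0 horner0.
have /closed_nonrootP[t] := PQR0.
rewrite rootE !hornerM !mulf_eq0 !negb_or => /andP[/andP[Pt Qt] Rt].
have gz := Rg _ Rt; have zM : Mimage (res_pt_of gz).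
  by apply/MimageP => //; eexists; first exact: gz.
have zr : reps (res (x + t *: (y - x))) (res_pt_of gz) by [].
have [|] := MAB _ zM; rewrite ?AE ?BE /=.
  move=> /(_ f Af _ zr)/eqP; rewrite -resE fP; exact/negP.
move=> /(_ g Bg _ zr)/eqP; rewrite -resE gQ; exact/negP.
Qed.

Definition Mbar_var Gam : projvar K := ProjVar (@Mbar_closed Gam) (@Mbar_irr Gam).

Definition rho Gam (H : ntube Gam) (p : pv_pt (Mbar_var Gam)) : pspace (tube_sp H) :=
  sval p H.

Definition Mact Gam Del (f : giso Gam Del)
    (p : forall H : ntube Del, pspace (tube_sp H)) (H : ntube Gam) : pspace (tube_sp H) :=
  proj_map (pull_inj K (@imset_map_surj Gam Del f (val H))) (p (giso_ntube f H)).

Definition Mact_vec Gam Del (f : giso Gam Del) (H : ntube Gam)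
    (x : forall H : ntube Del, tube_sp H) : tube_sp H :=
  pull K (@imset_map Gam Del f (val H)) (x (giso_ntube f H)).

Lemma Mact_reps Gam Del (f : giso Gam Del) x p :
  reps x p -> reps (fun H => Mact_vec f H x) (Mact f p).
Proof. by move=> xp H; exact: represents_proj_map (xp (giso_ntube f H)). Qed.

Lemma Mact_poly Gam Del (f : giso Gam Del) H :
  mhpoly_map (fun H' => (H' == giso_ntube f H) : nat) (Mact_vec f H).
Proof. exact: mhpoly_proj. Qed.

Lemma card_giso Gam Del (f : giso Gam Del) : #|Gam| = #|Del|.
Proof. exact: bij_eq_card (giso_bij f). Qed.

Lemma Mact_set Gam Del (f : giso Gam Del) p : Mbar_set p -> Mbar_set (Mact f p).
Proof.
rewrite /Mbar_set -(card_giso f); case: eqVneq => // G1.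
move: p; apply: (@zclosure_min _ _ _ _ (Mact f @^-1` zclosure (@Mimage Gam))).
  apply: (zclosed_preim (Mact_poly f)) (zclosed_zclosure _) => p x.
  exact: Mact_reps.
have D1 : #|Del| != 1%N by rewrite -(card_giso f).
move=> p /(MimageP p D1)[x gx xp]; apply: sub_zclosure; apply/MimageP => //.
exists (pull_ffun f x) => [v w vw|H].
  by rewrite !ffunE; apply: gx; rewrite giso_adj.
have := Mact_reps f xp H; congr represents.
rewrite /Mact_vec /res pullE; congr vcls.
by apply/ffunP => v; rewrite !ffunE.
Qed.

Definition Mact_fun Gam Del (f : giso Gam Del) (p : pv_pt (Mbar_var Del)) :
  pv_pt (Mbar_var Gam) := exist _ (Mact f (sval p)) (Mact_set f (svalP p)).

Lemma Mact_reg Gam Del (f : giso Gam Del) : regular (Mact_fun f).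
Proof.
apply: (@regular_global _ (Mbar_var Del) (Mbar_var Gam) (Mact_fun f) _ _ (Mact_poly f)).
by move=> q x xq; exact: Mact_reps.
Qed.

Definition Mact_mor Gam Del (f : giso Gam Del) : pvmor (Mbar_var Del) (Mbar_var Gam) :=
  PVMor (Mact_reg f).

Lemma proj_map_pull_eq Gam (p : forall H : ntube Gam, pspace (tube_sp H)) (S : finType)
  (H H' : ntube Gam) (i : S -> sub_fin (val H)) (j : S -> sub_fin (val H')) i0 j0 :
  H = H' -> (forall s, val (i s) = val (j s)) ->
  @proj_map K _ _ (pull K i) i0 (p H) = @proj_map K _ _ (pull K j) j0 (p H').
Proof.
move=> HH'; subst H' => ij; have {}ij : i = j.
  by apply: funext => s; apply: val_inj.
by subst j; apply: pspace_eq.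
Qed.

Lemma pull_id (S : finType) : pull K (@id S) = \1%VF.
Proof.
apply/lfunP; elim/vq_ind=> x; rewrite id_lfunE -[vq_proj _ x]/(vcls x) pullE.
by congr vcls; apply/ffunP => s; rewrite ffunE.
Qed.

Lemma pull_comp (S T U : finType) (g : T -> U) (f : S -> T) :
  pull K (g \o f) = (pull K f \o pull K g)%VF.
Proof.
apply/lfunP; elim/vq_ind=> x; rewrite comp_lfunE -[vq_proj _ x]/(vcls x) !pullE.
by congr vcls; apply/ffunP => s; rewrite !ffunE.
Qed.

Lemma Mact_id Gam : Mact_mor (giso_id Gam) = idm (Mbar_var Gam : pv_smcat K).
Proof.
apply: pvmor_eq => p; apply: pv_pt_eq => H /=.
have id0 : lker (pull K (@id (sub_fin (val H)))) == 0%VS.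
  by apply: pull_inj => t; exists t.
transitivity (proj_map id0 (sval p H)); last first.
  by apply: pspace_eq; rewrite /= pull_id lim1g.
apply: (@proj_map_pull_eq _ (sval p) _ (giso_ntube (giso_id Gam) H) H
  (@imset_map Gam Gam (giso_id Gam) (val H)) id) => //.
by apply: val_inj; rewrite /= imset_id.
Qed.

Lemma Mact_comp Gam Del Eps (g : giso Del Eps) (f : giso Gam Del) :
  Mact_mor (giso_comp g f) =
  cmp (c := pv_smcat K) (Mact_mor f) (Mact_mor g).
Proof.
apply: pvmor_eq => p; apply: pv_pt_eq => H /=.
pose k := @imset_map Del Eps g (f @: val H) \o @imset_map Gam Del f (val H).
have k_surj t : exists s, k s == t.
  have [u /eqP<-] := imset_map_surj t; have [s /eqP<-] := imset_map_surj u.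
  by exists s.
transitivity (proj_map (pull_inj K k_surj) (sval p (giso_ntube g (giso_ntube f H)))).
  apply: (@proj_map_pull_eq _ (sval p) _ (giso_ntube (giso_comp g f) H)
    (giso_ntube g (giso_ntube f H))
    (@imset_map Gam Eps (giso_comp g f) (val H)) k) => //.
  by apply: val_inj; rewrite /= imset_comp.
by apply: pspace_eq; rewrite /= /k pull_comp limg_comp.
Qed.

Definition Mbar : gcoll (pv_smcat K) :=
  @GColl (pv_smcat K) Mbar_var Mact_mor Mact_id Mact_comp.

Definition rains_generic (C : contractad Mbar) : Prop :=
  forall (Gam : cgraph) (G : tube Gam), (1 < #|G|)%N -> tset G != [set: Gam]%SET ->
  forall (p : pv_pt (pv_prod (Mbar_var (contr G)) (Mbar_var (induced G)))) (H : ntube Gam),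
    (forall sHG : val H \subset G,
      rho H ((ctr_comp C G : pvmor _ _) p) =
      proj_map (pull_inj K (@pre_ntube_surj Gam G H sHG))
        (rho (pre_ntube sHG) (pv_snd _ _ p))) /\
    (forall nHG : ~~ (val H \subset G),
      rho H ((ctr_comp C G : pvmor _ _) p) =
      proj_map (pull_inj K (@imset_map_surj Gam (contr G) (to_contr G) (val H)))
        (rho (img_ntube nHG) (pv_fst _ _ p))).

(* The infinitesimal compositions of [C] are the Rains maps.  For [G] a single
   vertex or all of [Gam], they are the projections to the only nontrivial
   factor, identified with the target by [contr1_iso] and [indT_iso].  The unit
   of [C] is a map from the point to the point. *)
Definition rains_compositions (C : contractad Mbar) : Prop :=
  [/\ rains_generic C,
      forall (Gam : cgraph) (v : Gam),
        cmp (gcoll_map Mbar (contr1_iso v)) (ctr_comp C (tube1 v)) = pv_fst _ _ &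
      forall Gam : cgraph,
        cmp (gcoll_map Mbar (indT_iso Gam)) (ctr_comp C (tubeT Gam)) = pv_snd _ _ ].

End Wonderful.

(* Main.v *)
(* The Rains map is multihomogeneous in coordinates, so it suffices to see that
   it sends generic points into the closure.  For generic [x] on [Gam/G] and [y]
   on [Gam|_G] the vector [x o to_contr + t y], with [y] extended by 0, is generic
   for all but finitely many [t], and as [t] tends to 0 its lines degenerate to
   the components of the Rains map; a multihomogeneous equation becomes a
   polynomial in [t] with infinitely many zeros.  The axioms are checked one
   component at a time: every component of an iterated Rains map is the pullback
   of a single component of one of its arguments, selected by tube inclusions. *)

Require Import Defs.
From mathcomp Require Import boolp classical_sets.
From mathcomp Require Import all_boot all_order all_algebra.
From mathcomp Require Import reals complex.

Set Implicit Arguments.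
Unset Strict Implicit.
Unset Printing Implicit Defensive.

Import GRing.Theory Num.Theory.
Local Open Scope ring_scope.

Section RainsMaps.
Variable K : numClosedFieldType.
Implicit Types Gam Del : cgraph.

Local Notation coords Gam := (forall H : ntube Gam, pspace (@tube_sp K Gam H)).

(** * Generic points and their closure *)

Definition gen_image Gam : set (coords Gam) :=
  [set p | exists2 x, generic x & reps (res x) p]%classic.

(** For a one-vertex graph [VS] has no lines and [Mimage] is empty, while [gen_image] is the whole
    one-point space, as there is no non-trivial tube. This makes that case uniform below. *)
Lemma Mbar_setE Gam : @Mbar_set K Gam = zclosure (@gen_image Gam).
Proof.
rewrite /Mbar_set; case: eqVneq => [G1|G1]; last first.
  by congr zclosure; apply/seteqP; split=> p /(MimageP p G1).
apply/seteqP; split=> // p _; apply: sub_zclosure.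
have [x gx] := @generic_ex K Gam; exists x => // H.
by move: (ntube_void H); rewrite G1.
Qed.

(** * The Rains map on coordinates, as a limit of generic points *)

Section Composition.
Variables (Gam : cgraph) (G : tube Gam).

Definition rains_coords (p : coords (contr G)) (q : coords (induced G)) : coords Gam :=
  fun H => match boolP (val H \subset tset G) with
  | AltTrue sHG => proj_map (pull_inj K (@pre_ntube_surj Gam G H sHG)) (q (pre_ntube sHG))
  | AltFalse nHG =>
    proj_map (pull_inj K (@imset_map_surj Gam (contr G) (to_contr G) (val H)))
      (p (img_ntube nHG))
  end.

Lemma rains_coords_in p q (H : ntube Gam) (sHG : val H \subset tset G) :
  rains_coords p q H =
  proj_map (pull_inj K (@pre_ntube_surj Gam G H sHG)) (q (pre_ntube sHG)).
Proof.
rewrite /rains_coords; case: {-}_ / boolP => [s|n]; last by case/negP: (n).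
by rewrite (bool_irrelevance s sHG).
Qed.

Lemma rains_coords_out p q (H : ntube Gam) (nHG : ~~ (val H \subset tset G)) :
  rains_coords p q H =
  proj_map (pull_inj K (@imset_map_surj Gam (contr G) (to_contr G) (val H)))
    (p (img_ntube nHG)).
Proof.
rewrite /rains_coords; case: {-}_ / boolP => [s|n]; first by case/negP: (nHG).
by rewrite (bool_irrelevance n nHG).
Qed.

Let X : projvar K := Mbar_var K (contr G).
Let Y : projvar K := Mbar_var K (induced G).

(** A component reads one coordinate of one factor through a linear map, so it has degree one there.
    Which coordinate depends on [H], hence the existential form. *)
Lemma rains_poly (H : ntube Gam) :
  exists d (F : (forall k, @prod_sp K X Y k) -> tube_sp K H),
  mhpoly_map d F /\
  forall (p : forall k, pspace (@prod_sp K X Y k)) x, reps x p ->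
    represents (F x) (rains_coords (prod_fst p) (prod_snd p) H).
Proof.
have [sHG|nHG] := boolP (val H \subset tset G).
  exists (fun j => (j == inr (pre_ntube sHG)) : nat).
  exists (fun x : forall k, @prod_sp K X Y k =>
    pull K (pre_ntube_map sHG) (x (inr (pre_ntube sHG)))).
  split; first exact: (@mhpoly_proj _ _ (@prod_sp K X Y) (inr (pre_ntube sHG))).
  move=> p x xp; rewrite rains_coords_in.
  exact: represents_proj_map (xp (inr (pre_ntube sHG))).
exists (fun j => (j == inl (img_ntube nHG)) : nat).
exists (fun x : forall k, @prod_sp K X Y k =>
  pull K (@imset_map Gam (contr G) (to_contr G) (val H))
  (x (inl (img_ntube nHG)))).
split; first exact: (@mhpoly_proj _ _ (@prod_sp K X Y) (inl (img_ntube nHG))).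
move=> p x xp; rewrite rains_coords_out.
exact: represents_proj_map (xp (inl (img_ntube nHG))).
Qed.

Definition ext0 (y : {ffun induced G -> K^o}) : {ffun Gam -> K^o} :=
  [ffun v => oapp y 0 (insub v)].

Lemma ext0E y (v : induced G) : ext0 y (val v) = y v.
Proof. by rewrite ffunE valK. Qed.

Variables (x : {ffun contr G -> K^o}) (y : {ffun induced G -> K^o}).
Hypotheses (gx : generic x) (gy : generic y).

Let x0 : {ffun Gam -> K^o} := pull_ffun (to_contr G) x.

(** All of [H] falls into one block, so [x0] is constant on it. *)
Lemma res_contr_sub (H : ntube Gam) : val H \subset tset G -> res x0 H = 0.
Proof.
move=> sHG; apply/eqP; rewrite vq_proj_eq0.
have [u _] := ntube_edge H; apply/vlineP; exists (x0 (val u)).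
apply/ffunP => v; rewrite !ffunE [_ *: _]mulr1; congr (x _).
by apply/eqP; rewrite to_contr_eq !(subsetP sHG _ (valP _)) orbT.
Qed.

(** The polynomial is the product of the differences along edges, as functions of [t]; the factor
    ['X] excludes [t = 0]. *)
Lemma generic_blow_up : exists2 P : {poly K}, P != 0 &
  forall t, P.[t] != 0 -> t != 0 /\ generic (x0 + t *: ext0 y).
Proof.
pose P e := (x0 e.1 - x0 e.2 : K)%:P + (ext0 y e.1 - ext0 y e.2 : K)%:P * 'X.
exists ('X * \prod_(e : Gam * Gam | adj e.1 e.2) P e).
  rewrite mulf_neq0 ?polyX_eq0 //; apply/prodf_neq0 => -[v w] /= vw.
  apply/eqP => P0.
  have /eqP := congr1 (fun p : {poly K} => p`_0) P0.
  rewrite /P !coefE /= mulr0 addr0 subr_eq0.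
  have /eqP := congr1 (fun p : {poly K} => p`_1) P0.
  rewrite /P !coefE /= add0r mulr1 subr_eq0.
  (* Inside [G] the linear coefficient is a difference of [y] along an edge; otherwise the ends lie
     in adjacent distinct blocks and the constant coefficient is such a difference of [x]. *)
  have [/andP[vG wG]|nG] := boolP ((v \in tset G) && (w \in tset G)).
    rewrite -[v]/(val (exist (fun u => u \in tset G) v vG)).
    rewrite -[w]/(val (exist (fun u => u \in tset G) w wG)) !ext0E.
    by move=> e1 _; have := gy (v := exist _ v vG) (w := exist _ w wG) vw; rewrite e1.
  move=> _; rewrite !ffunE; apply/negP/gx.
  have := gquot_weak (gquot_contr G) vw; rewrite to_contr_eq (negPf nG) orbF.
  by case: eqP vw => // ->; rewrite adj_irr.
move=> t; rewrite hornerM hornerX mulf_eq0 negb_or horner_prod.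
case/andP=> t0 /prodf_neq0 Pt; split=> // v w vw.
have := Pt (v, w) vw; apply: contra_neq => E.
have {}E : x0 v + t * ext0 y v = x0 w + t * ext0 y w by move: E; rewrite !ffunE.
rewrite /P !hornerE /= mulrBl ![ext0 y _ * t]mulrC.
by rewrite addrACA -opprD E subrr.
Qed.

(* [res (x0 + t *: ext0 y) H] is proportional to [lim_rep H + t *: dir_rep H]:
   on tubes inside [G] the restriction of [x0] is constant and [t] rescales away. *)
Let lim_rep (H : ntube Gam) : tube_sp K H :=
  if val H \subset tset G then res (ext0 y) H else res x0 H.
Let dir_rep (H : ntube Gam) : tube_sp K H :=
  if val H \subset tset G then 0 else res (ext0 y) H.

(** On tubes inside [G], [ext0 y] restricts to [y]; on the others, [x0] is pulled back from the
    image tube. These are the two cases of the Rains map. *)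
Lemma reps_rains_lim p q : reps (res x) p -> reps (res y) q ->
  reps lim_rep (rains_coords p q).
Proof.
move=> xp yq H; rewrite /lim_rep; case: ifPn => [sHG|nHG].
  rewrite rains_coords_in.
  have := represents_proj_map (pull_inj K (@pre_ntube_surj Gam G H sHG))
    (yq (pre_ntube sHG)).
  rewrite /res pullE; congr represents; congr vcls.
  by apply/ffunP => v; rewrite !ffunE /= -(ext0E y) ffunE.
rewrite rains_coords_out.
have := represents_proj_map
  (pull_inj K (@imset_map_surj Gam (contr G) (to_contr G) (val H))) (xp (img_ntube nHG)).
rewrite /res pullE; congr represents; congr vcls.
by apply/ffunP => v; rewrite !ffunE.
Qed.

Lemma rains_generic_Mbar p q : reps (res x) p -> reps (res y) q ->
  Mbar_set (rains_coords p q).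
Proof.
move=> xp yq; rewrite Mbar_setE => C /= [[S [SP ->]] genC] f Sf.
have [d df] := SP f Sf; apply/(vanishesP df (reps_rains_lim xp yq)).
(* [P] is [f] along the line of representatives; the value sought is [P.[0]]. *)
have [P fP] := mhpoly_line lim_rep dir_rep df.
suff P0 : P = 0.
  rewrite -[RHS](horner0 0) -P0 -fP; congr f.
  by apply: functional_extensionality_dep => H; rewrite scale0r addr0.
have [Q Q0 Qgen] := generic_blow_up.
apply/eqP/negPn/negP => P0.
have /closed_nonrootP[t] : P * Q != 0 by rewrite mulf_neq0.
rewrite rootE hornerM mulf_eq0 negb_or => /andP[/eqP Pt /Qgen[t0 gz]]; apply: Pt.
have fz : f (res (x0 + t *: ext0 y)) = 0.
  by apply: (genC (res_pt_of gz)) Sf _ _ => //; exists (x0 + t *: ext0 y).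
(* Inside [G] only [t *: res (ext0 y) H] survives; [c] takes out this factor [t], and by homogeneity
   [f] changes by a nonzero scalar. *)
pose c (H : ntube Gam) : K := if val H \subset tset G then t else 1.
have resE : res (x0 + t *: ext0 y) = fun H => c H *: (lim_rep H + t *: dir_rep H).
  apply: functional_extensionality_dep => H; rewrite res_line /c /lim_rep /dir_rep.
  by case: ifP => [/res_contr_sub->|_]; rewrite ?scaler0 ?add0r ?addr0 ?scale1r.
move/eqP: fz; rewrite resE (mhpoly_homog df) mulf_eq0 => /orP[|/eqP]; last by rewrite fP.
move/negPn/negP; case; apply/prodf_neq0 => H _; apply: expf_neq0.
by rewrite /c; case: ifP => // _; exact: oner_neq0.
Qed.

End Composition.

(** * The Rains maps as morphisms of compactifications *)

Section CompositionMbar.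
Variables (Gam : cgraph) (G : tube Gam).
Let X : projvar K := Mbar_var K (contr G).
Let Y : projvar K := Mbar_var K (induced G).

(** Slices of a closed set are closed, so one argument is made generic at a time: first [q] for
    fixed [p], then [p] for that generic [q]. *)
Lemma rains_Mbar (p : coords (contr G)) (q : coords (induced G)) :
  Mbar_set p -> Mbar_set q -> Mbar_set (rains_coords p q).
Proof.
have cl : zclosed ((fun r : forall k, pspace (@prod_sp K X Y k) =>
    rains_coords (prod_fst r) (prod_snd r)) @^-1` @Mbar_set K Gam)%classic.
  have dF (H : ntube Gam) := projT2 (cid (projT2 (cid (rains_poly G H)))).
  exact: (zclosed_preim (fun H => (dF H).1) (fun p x xp H => (dF H).2 p x xp)
    (@Mbar_closed K Gam)).
move=> pM; move: q; rewrite Mbar_setE.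
apply: (@zclosure_min _ _ _ _ (rains_coords p @^-1` @Mbar_set K Gam)%classic).
  exact: (@slice1_closed K X Y p _ cl).
move=> q [y gy yq]; move: p pM; rewrite Mbar_setE.
apply: (@zclosure_min _ _ _ _ ((rains_coords (G := G))^~ q @^-1` @Mbar_set K Gam)%classic).
  exact: (@slice2_closed K X Y q _ cl).
by move=> p [x gx xp]; exact: (rains_generic_Mbar gx gy xp yq).
Qed.

Definition rains_fun (r : pv_pt (pv_prod X Y)) : pv_pt (Mbar_var K Gam) :=
  exist _ (rains_coords (prod_fst (sval r)) (prod_snd (sval r)))
    (rains_Mbar (svalP r).1 (svalP r).2).

Lemma rains_reg : regular rains_fun.
Proof.
have dF (H : ntube Gam) := projT2 (cid (projT2 (cid (rains_poly G H)))).
exact: (@regular_global _ (pv_prod X Y) (Mbar_var K Gam) rains_fun _ _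
  (fun H => (dF H).1) (fun p x xp H => (dF H).2 _ x xp)).
Qed.

Definition rains_mor : pvmor (pv_prod X Y) (Mbar_var K Gam) := PVMor rains_reg.

End CompositionMbar.

(** * The unit *)

Lemma regular_cst (X Y : projvar K) (q : pv_pt Y) : regular (fun _ : pv_pt X => q).
Proof.
have [y yq] := reps_ex (sval q).
exact: (regular_global (fun j => @mhpoly_cst _ _ (pv_sp (p := X)) _ (y j))).
Qed.

(** [P1] has no non-trivial tube, so the target has one point and the choice is forced. *)
Definition Mbar_unit : pvmor (pv_pnt K) (Mbar_var K P1) :=
  PVMor (@regular_cst (pv_pnt K) (Mbar_var K P1) (exist _ _ (projT2 (cid (Mbar_irr K P1).1)))).

(** * Following single coordinates through compositions *)

(* [coord p i L]: [i] factors as a surjection onto a non-trivial tube [H], and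
   [L] is the pullback of the [H]-coordinate of [p]. *)
Definition coord Gam (p : coords Gam) (S : finType) (i : S -> Gam) (L : pspace (VS K S)) :=
  exists (H : ntube Gam) (j : S -> sub_fin (val H)),
  [/\ forall s, val (j s) = i s, forall t, exists s, j s == t &
      val L = (pull K j @: val (p H))%VS].

Lemma coord_val Gam (p : coords Gam) (H : ntube Gam) :
  coord p (val : sub_fin (val H) -> Gam) (p H).
Proof.
by exists H, id; split=> // [t|]; [exists t | rewrite pull_id lim1g].
Qed.

(** The tube is the image of [i], and [j] is [i] with restricted codomain, so [p] and [i] determine
    [L]. Comparing lines thus reduces to comparing vertex maps. *)
Lemma coord_inj Gam (p : coords Gam) (S : finType) (i i' : S -> Gam) L L' :
  i =1 i' -> coord p i L -> coord p i' L' -> L = L'.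
Proof.
move=> ii' [H [j [jE js LE]]] [H' [j' [jE' js' LE']]].
have HE : H = H'.
  apply/val_inj/setP => v; apply/idP/idP => vH.
    have [s /eqP sv] := js (exist _ v vH).
    by rewrite -[v]/(val (exist (fun v => v \in val H) v vH)) -sv jE ii' -jE' (valP (j' s)).
  have [s /eqP sv] := js' (exist _ v vH).
  by rewrite -[v]/(val (exist (fun v => v \in val H') v vH)) -sv jE' -ii' -jE (valP (j s)).
subst H'; apply: pspace_eq; rewrite LE LE'; congr (pull K _ @: _)%VS.
by apply: funext => s; apply: val_inj; rewrite jE jE' ii'.
Qed.

Lemma coord_nontrivial Gam (p : coords Gam) (S : finType) (i : S -> Gam) L :
  coord p i L -> #|Gam| != 1%N.
Proof. by case=> H _; exact: ntube_void H. Qed.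

Lemma coord_Mact Gam Del (f : giso Gam Del) (p : coords Del) (S : finType)
  (i : S -> Gam) L : coord (Mact f p) i L -> coord p (f \o i) L.
Proof.
case=> H [j [jE js LE]]; exists (giso_ntube f H), (imset_map f (A := val H) \o j).
split=> [s|t|].
- by rewrite /= jE.
- have [a /eqP<-] := imset_map_surj t; have [s /eqP<-] := js a.
  by exists s.
- by rewrite LE /= -limg_comp -pull_comp.
Qed.

(** The second case keeps a vertex outside [G], which later refutes mismatched branches. *)
Lemma coord_rains Gam (G : tube Gam) (p : coords (contr G)) (q : coords (induced G))
  (S : finType) (i : S -> Gam) L : coord (rains_coords p q) i L ->
  (exists2 i' : S -> induced G, forall s, val (i' s) = i s & coord q i' L) \/
  (exists s, i s \notin tset G) /\ coord p (to_contr G \o i) L.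
Proof.
case=> H [j [jE js LE]]; have [sHG|nHG] := boolP (val H \subset tset G).
  left; exists (pre_ntube_vert sHG \o j) => [s|]; first by rewrite /= jE.
  exists (pre_ntube sHG), (pre_ntube_map sHG \o j); split=> // [t|].
    have [a /eqP<-] := pre_ntube_surj t; have [s /eqP<-] := js a.
    by exists s.
  by rewrite LE rains_coords_in /= -limg_comp -pull_comp.
right; split.
  case/subsetPn: (nHG) => v vH vG; have [s /eqP sv] := js (exist _ v vH).
  by exists s; rewrite -jE sv.
exists (img_ntube nHG), (imset_map (to_contr G) (A := val H) \o j); split=> [s|t|].
- by rewrite /= jE.
- have [a /eqP<-] := imset_map_surj t; have [s /eqP<-] := js a.
  by exists s.
- by rewrite LE rains_coords_out /= -limg_comp -pull_comp.
Qed.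

(** Free variables [L] and [M] in place of the coordinates let [coord_Mact] and [coord_rains] unwind
    both sides. *)
Lemma pv_pt_coord Gam (p q : pv_pt (Mbar_var K Gam)) :
  (forall (H : ntube Gam) (L M : pspace (tube_sp K H)),
     coord (sval p) (val : sub_fin (val H) -> Gam) L ->
     coord (sval q) (val : sub_fin (val H) -> Gam) M -> L = M) -> p = q.
Proof.
move=> pq; apply: pv_pt_eq => H; apply: pq; exact: coord_val.
Qed.

(** * The contractad axioms, coordinate by coordinate *)

Lemma rains_nat Gam Del (f : giso Gam Del) (G : tube Gam) :
  cmp (c := pv_smcat K) (Mact_mor K f) (rains_mor (giso_tube f G)) =
  cmp (c := pv_smcat K) (rains_mor G)
   (tensor_hom (s := pv_smcat K) (Mact_mor K (giso_contr f G)) (Mact_mor K (giso_ind f G))).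
Proof.
have memf v : (f v \in tset (giso_tube f G)) = (v \in tset G).
  by rewrite mem_imset //; exact: bij_inj (giso_bij f).
apply: pvmor_eq => r; apply: pv_pt_coord => H L M /coord_Mact/coord_rains HL /coord_rains HM.
(* By [memf] both sides take the same branch; the two mixed cases are void. *)
case: HL HM => [[i iE cL]|[[s sG] cL]] [[k kE /coord_Mact cM]|[[u uG] /coord_Mact cM]].
- apply: coord_inj cL cM => s; apply: val_inj.
  by rewrite iE /= kE.
- by case/negP: uG; rewrite -memf -[f (val u)]iE; exact: valP.
- by case/negP: sG; rewrite /= memf -kE; exact: valP.
- apply: coord_inj cL cM => t; exact: esym (quot_iso_funE _ (giso_contr_fib f G) _).
Qed.

Lemma rains_unitr Gam (v : Gam) :
  cmp (c := pv_smcat K) (rains_mor (tube1 v))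
    (tensor_hom (s := pv_smcat K) (Mact_mor K (contr1_iso v))
      (cmp (c := pv_smcat K) (Mact_mor K (ind1_iso v)) Mbar_unit)) =
  runitor (s := pv_smcat K) (Mbar_var K Gam).
Proof.
apply: pvmor_eq => r; apply: pv_pt_coord => H L M /coord_rains HL cM.
(* A branch inside the single vertex would give a non-trivial tube in a one-vertex graph. *)
case: HL => [[i _ /coord_nontrivial]|[_ /coord_Mact cL]].
  by rewrite card_ind1.
by apply: coord_inj cL cM => s; exact: (quot_iso_funE _ (contr1_fib v) _).
Qed.

Lemma rains_unitl Gam :
  cmp (c := pv_smcat K) (rains_mor (tubeT Gam))
    (tensor_hom (s := pv_smcat K)
      (cmp (c := pv_smcat K) (Mact_mor K (contrT_iso Gam)) Mbar_unit)
      (Mact_mor K (indT_iso Gam))) =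
  lunitor (s := pv_smcat K) (Mbar_var K Gam).
Proof.
apply: pvmor_eq => r; apply: pv_pt_coord => H L M /coord_rains HL cM.
case: HL => [[i iE /coord_Mact cL]|[[s] ]]; last by rewrite inE.
by apply: coord_inj cL cM => s; rewrite /= iE.
Qed.

Lemma rains_contr1 Gam (v : Gam) :
  cmp (c := pv_smcat K) (Mact_mor K (contr1_iso v)) (rains_mor (tube1 v)) =
  pv_fst (Mbar_var K (contr (tube1 v))) (Mbar_var K (induced (tube1 v))).
Proof.
apply: pvmor_eq => r; apply: pv_pt_coord => H L M /coord_Mact/coord_rains HL cM.
case: HL => [[i _ /coord_nontrivial]|[_ cL]].
  by rewrite card_ind1.
apply: coord_inj cL cM => s /=.
(* A quotient isomorphism can be evaluated only on a vertex given as a block. *)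
have [x /eqP<-] := block_surj (val s); congr block.
exact: (quot_iso_funE _ (contr1_fib v) x).
Qed.

Lemma rains_indT Gam :
  cmp (c := pv_smcat K) (Mact_mor K (indT_iso Gam)) (rains_mor (tubeT Gam)) =
  pv_snd (Mbar_var K (contr (tubeT Gam))) (Mbar_var K (induced (tubeT Gam))).
Proof.
apply: pvmor_eq => r; apply: pv_pt_coord => H L M /coord_Mact/coord_rains HL cM.
case: HL => [[i iE cL]|[[s] ]]; last by rewrite inE.
by apply: coord_inj cL cM => s; apply: val_inj; rewrite /= iE.
Qed.

Lemma par_ind_isoE Gam (G1 G2 : tube Gam) (d12 : [disjoint G1 & G2])
  (k : induced (img_tube G1 G2)) (x : induced G2) :
  val k = to_contr G1 (val x) -> par_ind_iso d12 k = x.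
Proof.
move=> kx; have -> : k = imset_map (to_contr G1) x by apply: val_inj.
exact: (@quot_iso_funE _ _ _ _ id (gquot_imset_map (par_ind_compat d12)) (par_ind_fib d12) x).
Qed.

Lemma rains_par Gam (G1 G2 : tube Gam)
    (d12 : [disjoint G1 & G2]) (d21 : [disjoint G2 & G1]) :
  let: A := Mbar_var K (contr (img_tube G1 G2)) in
  let: B2 := Mbar_var K (induced G2) in
  let: B1 := Mbar_var K (induced G1) in
  cmp (c := pv_smcat K) (rains_mor G1) (tensor_hom (s := pv_smcat K)
    (cmp (c := pv_smcat K) (rains_mor (img_tube G1 G2))
      (tensor_hom (s := pv_smcat K) (idm (A : pv_smcat K)) (Mact_mor K (par_ind_iso d12))))
    (idm (B1 : pv_smcat K))) =
  cmp (cmp (c := pv_smcat K) (rains_mor G2) (tensor_hom (s := pv_smcat K)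
    (cmp (c := pv_smcat K) (rains_mor (img_tube G2 G1))
      (tensor_hom (s := pv_smcat K) (Mact_mor K (par_contr_iso d12))
        (Mact_mor K (par_ind_iso d21))))
    (idm (B2 : pv_smcat K))))
    (cmp (cmp (associator_inv (s := pv_smcat K) A B1 B2)
      (tensor_hom (s := pv_smcat K) (idm (A : pv_smcat K))
        (braiding (s := pv_smcat K) B2 B1)))
      (associator (s := pv_smcat K) A B2 B1)).
Proof.
have mem12 x : (to_contr G1 x \in tset (img_tube G1 G2)) = (x \in tset G2).
  by rewrite mem_img_block // d12 orbT.
have mem21 x : (to_contr G2 x \in tset (img_tube G2 G1)) = (x \in tset G1).
  by rewrite mem_img_block // d21 orbT.
apply: pvmor_eq => r; apply: pv_pt_coord => H L M /coord_rains HL /coord_rains HM.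
(* On each side the tube lies in [G1], in [G2] or in neither, and only matching cases survive; the
   vertex [u] shows that it cannot lie in both. *)
have [u _] := ntube_edge H.
case: HL => [[i iE cL]|[[s sG1] /coord_rains[[i iE /coord_Mact cL]|[[t tG cL]]]]];
case: HM => [[k kE cM]|[[v vG2] /coord_rains[[k kE /coord_Mact cM]|[[w wG /coord_Mact cM]]]]].
- have uG1 := valP (i u); have uG2 := valP (k u).
  by rewrite iE in uG1; rewrite kE (disjointFr d12 uG1) in uG2.
- apply: coord_inj cL cM => t; apply/esym/par_ind_isoE.
  by rewrite iE; exact: kE.
- by case/negP: wG; rewrite mem21 -iE; exact: valP.
- apply: coord_inj cL cM => t; apply/par_ind_isoE.
  by rewrite kE; exact: iE.
- by case/negP: vG2; rewrite -mem12 -[to_contr _ _]iE; exact: valP.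
- by case/negP: vG2; rewrite -mem12 -[to_contr _ _]iE; exact: valP.
- by case/negP: tG; rewrite mem12 -kE; exact: valP.
- by case/negP: sG1; rewrite -mem21 -[to_contr _ _]kE; exact: valP.
- apply: coord_inj cL cM => x.
  exact: esym (quot_iso_funE _ (par_contr_fib d12) _).
Qed.

Lemma rains_seq Gam (G H : tube Gam) (sGH : G \subset H) :
  let: A := Mbar_var K (contr H) in
  let: B := Mbar_var K (contr (pre_tube sGH)) in
  let: C := Mbar_var K (induced G) in
  cmp (c := pv_smcat K) (rains_mor H) (tensor_hom (s := pv_smcat K)
    (idm (A : pv_smcat K))
    (cmp (c := pv_smcat K) (rains_mor (pre_tube sGH))
      (tensor_hom (s := pv_smcat K) (idm (B : pv_smcat K)) (Mact_mor K (ind_ind_iso sGH))))) =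
  cmp (cmp (c := pv_smcat K) (rains_mor G) (tensor_hom (s := pv_smcat K)
    (cmp (c := pv_smcat K) (rains_mor (img_tube G H))
      (tensor_hom (s := pv_smcat K) (Mact_mor K (contr_contr_iso sGH))
        (Mact_mor K (ind_contr_iso sGH))))
    (idm (C : pv_smcat K))))
    (associator_inv (s := pv_smcat K) A B C).
Proof.
have memH x : (to_contr G x \in tset (img_tube G H)) = (x \in tset H).
  by rewrite mem_img_block // sGH.
have memG (x : induced H) : (x \in tset (pre_tube sGH)) = (val x \in tset G).
  by rewrite inE.
apply: pvmor_eq => r; apply: pv_pt_coord => T L M /coord_rains HL /coord_rains HM.
(* On each side the tube lies in [G], in [H] but not in [G], or not in [H]. The three matching cases
   use [ind_ind_iso], [ind_contr_iso] and [contr_contr_iso]. *)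
case: HL => [[i iE /coord_rains[[j jE /coord_Mact cL]|[[s sG] cL]]]|[[s sH] cL]];
case: HM => [[k kE cM]|[[v vG] /coord_rains[[k kE /coord_Mact cM]|[[w wH] /coord_Mact cM]]]].
- apply: coord_inj cL cM => s; apply: val_inj.
  by rewrite kE -iE -jE.
- by case/negP: vG; rewrite -iE -memG -jE; exact: valP.
- by case/negP: vG; rewrite -iE -memG -jE; exact: valP.
- by case/negP: sG; rewrite memG iE -kE; exact: valP.
- apply: coord_inj cL cM => x.
  have kx : k x = imset_map (to_contr G) (i x).
    by apply: val_inj; rewrite /= iE; exact: kE.
  rewrite /comp kx; apply: esym.
  exact: (@quot_iso_funE _ _ _ _ (to_contr (pre_tube sGH))
    (gquot_imset_map (ind_contr_compat sGH)) (ind_contr_fib sGH) (i x)).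
- by case/negP: wH; rewrite memH -iE; exact: valP.
- by case/negP: sH; rewrite (subsetP sGH) // -kE; exact: valP.
- by case/negP: sH; rewrite -memH -[to_contr _ _]kE; exact: valP.
- apply: coord_inj cL cM => x.
  exact: esym (quot_iso_funE _ (contr_contr_fib sGH) _).
Qed.

Definition rains_contractad : contractad (Mbar K) :=
  @Contractad (pv_smcat K) (Mbar K) Mbar_unit rains_mor
    rains_nat rains_unitr rains_unitl rains_par rains_seq.

Lemma rains_contractad_compositions : rains_compositions rains_contractad.
Proof.
split; [move=> Gam G _ _ p H | exact: rains_contr1 | exact: rains_indT].
by split=> sH; [exact: rains_coords_in | exact: rains_coords_out].
Qed.

End RainsMaps.

Theorem proposition3p6p2 (R : realType) :
  exists C : contractad (Mbar (R[i] : numClosedFieldType)), rains_compositions C.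
Proof. by exists (rains_contractad R[i]); exact: rains_contractad_compositions. Qed.
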